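(* The form $\mathcal{A}:H\times H\to\mathbb{R}$ defined by $$\begin{aligned}\mathcal{A}(u,v)=\ &\mathcal{C}_1\int_{\Omega_2^c}\int_{\Omega_2^c}\frac{(u_1(x)-u_1(y))(v_1(x)-v_1(y))}{|x-y|^{n+2s_1}}\,\mathrm{d}y\,\mathrm{d}x+\mathcal{C}_2\int_{\Omega_1^c}\int_{\Omega_1^c}\frac{(u_2(x)-u_2(y))(v_2(x)-v_2(y))}{|x-y|^{n+2s_2}}\,\mathrm{d}y\,\mathrm{d}x\\&+\int_{\Omega_1}\int_{\Omega_2}J(x-y)(u_1(x)-u_2(y))(v_1(x)-v_2(y))\,\mathrm{d}y\,\mathrm{d}x\end{aligned}$$ is bilinear, continuous and coercive; that is, there exist positive constants $M$ and $\alpha$ such that $\mathcal{A}(u,v)\le M|u|_H|v|_H$ and $\mathcal{A}(v,v)\ge\alpha|v|_H^2$ for all $u,v\in H$.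
   Context: Setting. Let $n\ge 2$, $s_1,s_2\in(0,1)$, and let $\Omega_1,\Omega_2\subset\mathbb{R}^n$ be open, connected, bounded domains with Lipschitz boundaries and $\overline{\Omega}_1\cap\overline{\Omega}_2=\emptyset$; $d:=\mathrm{dist}(\Omega_1,\Omega_2)>0$. $\Omega^c$ denotes the complement of $\Omega$ in $\mathbb{R}^n$. The kernel $J:\mathbb{R}^n\to\mathbb{R}$ is measurable and satisfies: $J(z)\ge 0$ and $J(z)=J(-z)$ for a.e. $z$; $J\in L^1(\mathbb{R}^n)$; there exists $r>d$ such that $B_r(0)\subset\mathrm{supp}(J)$. For $i\in\{1,2\}$, $\mathcal{C}_i=c(n,s_i)/2$, where $c(n,s_i)>0$ is the normalization constant of the fractional Laplacian $(-\Delta)^{s_i}$ on $\mathbb{R}^n$. Spaces. For $s\in(0,1)$, $\tilde H^s(\Omega)$ is the closure of $C_0^\infty(\Omega)$ in $H^s(\mathbb{R}^n)$ (equivalently, functions of $H^s(\mathbb{R}^n)$ supported in $\overline\Omega$), with norm $|v|_{\tilde H^s(\Omega)}^2=\int_{\mathbb{R}^n}\int_{\mathbb{R}^n}\frac{|v(x)-v(y)|^2}{|x-y|^{n+2s}}\,\mathrm{d}x\,\mathrm{d}y$; its elements vanish outside $\Omega$. $H:=\tilde H^{s_1}(\Omega_1)\oplus\tilde H^{s_2}(\Omega_2)=\{u=u_1+u_2:u_i\in\tilde H^{s_i}(\Omega_i)\}$, with norm $|u|_H=(|u_1|^2_{\tilde H^{s_1}(\Omega_1)}+|u_2|^2_{\tilde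 H^{s_2}(\Omega_2)})^{1/2}$. *)

(* Defs.v *)
From HB Require Import structures.
From mathcomp Require Import all_boot all_order all_algebra.
From mathcomp Require Import all_classical all_reals all_analysis.
From mathcomp Require Import measurable_realfun.

Set Implicit Arguments.
Unset Strict Implicit.
Unset Printing Implicit Defensive.

Import Order.TTheory GRing.Theory Num.Theory.
Import numFieldNormedType.Exports.

Local Open Scope classical_set_scope.
Local Open Scope ring_scope.

(* The sigma-algebra of R^n is generated by the coordinates; as [open_mrV]
   below shows, it contains the open sets, so it is the Borel one. *)
Section measurable_rV.
Context (R : realType) (n : nat).

Let coors : 'I_n -> 'rV[R]_n -> R := fun i x => x 0 i.

Let rV_set0 : g_sigma_preimage coors set0.
Proof. exact: sigma_algebra0. Qed.

Let rV_setC A : g_sigma_preimage coors A -> g_sigma_preimage coors (~` A).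
Proof. exact: sigma_algebraC. Qed.

Let rV_bigcup (F : (set 'rV[R]_n)^nat) :
  (forall i, g_sigma_preimage coors (F i)) ->
  g_sigma_preimage coors (\bigcup_i (F i)).
Proof. exact: sigma_algebra_bigcup. Qed.

HB.instance Definition _ := @isMeasurable.Build default_measure_display
  'rV[R]_n (g_sigma_preimage coors) rV_set0 rV_setC rV_bigcup.

Lemma measurable_coord (i : 'I_n) :
  measurable_fun [set: 'rV[R]_n] (fun x : 'rV[R]_n => x 0 i).
Proof.
move=> _ Y mY; rewrite setTI; apply: sub_sigma_algebra => /=.
rewrite -bigcup_seq/=; exists i => /=; first by rewrite mem_index_enum.
by exists Y => //; rewrite setTI.
Qed.

Lemma measurable_fun_rV d (T : measurableType d) (f : T -> 'rV[R]_n) :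
  (forall i, measurable_fun setT (fun t => f t 0 i)) -> measurable_fun setT f.
Proof.
move=> mf _ Y; rewrite /measurable /= setTI => mY.
suff: g_sigma_preimage coors `<=` [set Z | measurable (f @^-1` Z)] by apply.
apply: smallest_sub.
  split=> /= [|Z mZ|F mF]; first by rewrite preimage_set0.
  - by rewrite setTD preimage_setC; exact: measurableC.
  - by rewrite preimage_bigcup; exact: bigcupT_measurable.
rewrite -bigcup_seq => Z [i _ [W mW <-]] /=.
by rewrite setTI -[X in measurable X]setTI; exact: (mf i).
Qed.

Lemma open_mrV (A : set 'rV[R]_n) : open A -> measurable A.
Proof.
move=> oA.
pose D := [set p : 'rV[rat]_n * nat |
  ball (map_mx (@ratr R) p.1) p.2.+1%:R^-1 `<=` A].
have mball (c : 'rV[R]_n) (e : R) : 0 < e -> measurable (ball c e).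
  move=> e0.
  have -> : ball c e = \bigcap_(i in [set: 'I_n]) ((fun x => x 0 i) @^-1` ball (c 0 i) e).
    apply/seteqP; split => [x [_ cx] i _ /=|x cx]; first exact: cx.
    by split => // i j; rewrite (ord1 i); exact: cx.
  apply: fin_bigcap_measurable => // i _.
  rewrite -[X in measurable X]setTI; apply: measurable_coord => //.
  exact: measurable_ball.
have -> : A = \bigcup_(p in D) ball (map_mx (@ratr R) p.1) p.2.+1%:R^-1.
  apply/seteqP; split => [x Ax|x [p Dp]]; last exact: Dp.
  have [e /= e0 xeA] : exists2 e : R, 0 < e & ball x e `<=` A.
    have /nbhs_ballP[e e0 eA] : nbhs x A by exact: open_nbhs_nbhs.
    by exists e.
  have [k ke] : exists k : nat, k.+1%:R^-1 < e / 2 :> R.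
    have [k _ /(_ k (leqnn k))] := near_infty_natSinv_lt (PosNum (divr_gt0 e0 (ltr0n _ 2))).
    by exists k.
  have k0 : 0 < k.+1%:R^-1 :> R by rewrite invr_gt0.
  have [c cx] : exists c : 'rV[rat]_n, ball (map_mx (@ratr R) c) k.+1%:R^-1 x.
    have H i : exists q : rat, x 0 i - k.+1%:R^-1 < ratr q < x 0 i + k.+1%:R^-1.
      have [|q] := @rat_in_itvoo R (x 0 i - k.+1%:R^-1) (x 0 i + k.+1%:R^-1).
        by rewrite ltrD2l gtrN.
      by rewrite in_itv /= => ?; exists q.
    have [f fP] := choice H.
    exists (\row_i f i); split => // i j; rewrite (ord1 i) !mxE /ball /=.
    by rewrite distrC ltr_distlC fP.
  exists (c, k) => //= y cy; apply: xeA.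
  rewrite (splitr e); apply: (@ball_triangle _ _ (map_mx (@ratr R) c)).
    by apply/ball_sym/(le_ball (ltW ke)).
  exact: (le_ball (ltW ke)).
rewrite bigcup_mkcond; apply: countable_bigcupT_measurable => [|p].
  exact: countableP.
by case: ifPn => // _; apply: mball; rewrite invr_gt0.
Qed.

End measurable_rV.

Section lebesgue_rV_step.
Context (R : realType) (n : nat).

Definition rV_cons (p : measurableTypeR R * 'rV[R]_n) : 'rV[R]_n.+1 :=
  \row_i if unlift 0 i is Some j then p.2 0 j else p.1.

Let rV_cons0 p : rV_cons p 0 0 = p.1.
Proof. by rewrite mxE unlift_none. Qed.

Let rV_consS p j : rV_cons p 0 (lift 0 j) = p.2 0 j.
Proof. by rewrite mxE liftK. Qed.

Lemma measurable_rV_cons : measurable_fun setT rV_cons.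
Proof.
apply: measurable_fun_rV => i; have [j|] := unliftP 0 i => ->.
  rewrite (_ : (fun _ => _) = (fun x : 'rV[R]_n => x 0 j) \o snd).
    by apply: measurableT_comp; [exact: measurable_coord|].
  by apply/funext => p; exact: rV_consS.
by rewrite (_ : (fun _ => _) = fst) //; apply/funext => p; exact: rV_cons0.
Qed.

Let rV_uncons (v : 'rV[R]_n.+1) : measurableTypeR R * 'rV[R]_n :=
  (v 0 0, \row_i v 0 (lift 0 i)).

Let measurable_rV_uncons : measurable_fun setT rV_uncons.
Proof.
apply: measurable_fun_pair; first exact: measurable_coord.
apply: measurable_fun_rV => i.
rewrite (_ : (fun _ => _) = (fun v : 'rV[R]_n.+1 => v 0 (lift 0 i))).
  exact: measurable_coord.
by apply/funext => v; rewrite mxE.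
Qed.

Let rV_consK : cancel rV_cons rV_uncons.
Proof.
move=> [t x]; rewrite /rV_uncons rV_cons0; congr pair.
by apply/rowP => i; rewrite mxE rV_consS.
Qed.

Variable mu : {sigma_finite_measure set 'rV[R]_n -> \bar R}.

Definition lebesgue_step : set 'rV[R]_n.+1 -> \bar R :=
  pushforward (lebesgue_measure \x mu)%E rV_cons.

Let m := measure_function_pushforward__canonical__measure_function_Measure
  (lebesgue_measure \x mu)%E measurable_rV_cons.

HB.instance Definition _ := isMeasure.Build _ _ _ lebesgue_step
  (measure0 m) (measure_ge0 m) (@measure_semi_sigma_additive _ _ _ m).

Let lebesgue_step_sigma_finite : sigma_finite setT lebesgue_step.
Proof.
have /sigma_finiteP[F [TF ndF Foo]] := sigma_finiteT (@lebesgue_measure R).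
have /sigma_finiteP[G [TG ndG Goo]] := sigma_finiteT mu.
exists (fun k => rV_uncons @^-1` (F k `*` G k)) => [|k].
  rewrite -preimage_bigcup (_ : \bigcup_k _ = setT) ?preimage_setT//.
  apply/seteqP; split => // -[t x] _.
  have [i _ Fit] : (\bigcup_k F k) t by rewrite -TF.
  have [j _ Gjx] : (\bigcup_k G k) x by rewrite -TG.
  exists (maxn i j) => //; split.
    by move: t Fit; exact/subsetPset/ndF/leq_maxl.
  by move: x Gjx; exact/subsetPset/ndG/leq_maxr.
have [mFk Fkoo] := Foo k; have [mGk Gkoo] := Goo k; split.
  rewrite -[X in measurable X]setTI; apply: measurable_rV_uncons => //.
  exact: measurableX.
rewrite /lebesgue_step /pushforward -comp_preimage.
rewrite (_ : rV_uncons \o rV_cons = id); last exact/funext/rV_consK.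
by rewrite preimage_id product_measure1E// lte_mul_pinfty// ge0_fin_numE.
Qed.

HB.instance Definition _ := Measure_isSigmaFinite.Build _ _ _ lebesgue_step
  lebesgue_step_sigma_finite.

Lemma lebesgue_step_box (A : 'I_n.+1 -> set R) :
  (forall i, measurable (A i)) ->
  (lebesgue_step [set v | forall i, A i (v ord0 i)] = lebesgue_measure (A ord0) *
   mu [set v | forall i, A (lift ord0 i) (v ord0 i)])%E.
Proof.
move=> mA.
have mB : measurable [set v : 'rV[R]_n | forall i, A (lift ord0 i) (v ord0 i)].
  suff -> : [set v : 'rV[R]_n | forall i, A (lift ord0 i) (v ord0 i)] =
      \bigcap_(i in [set: 'I_n])
        (fun v : 'rV[R]_n => v ord0 i) @^-1` A (lift ord0 i).
    apply: fin_bigcap_measurable => // i _.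
    by rewrite -[X in measurable X]setTI; exact: measurable_coord.
  by apply/seteqP; split => [v Av i _|v Av i]; [exact: Av|exact: (Av i)].
rewrite -product_measure1E /lebesgue_step /pushforward //; last exact: mA.
congr (product_measure1 _ _ _).
apply/seteqP; split=> [p Ap|p [Ap1 Ap2] i] /=.
  split => [|i] /=; first by rewrite -rV_cons0; exact: Ap.
  by rewrite -rV_consS; exact: Ap.
have [j|] := unliftP 0 i => ->; first by rewrite rV_consS; exact: Ap2.
by rewrite rV_cons0.
Qed.

End lebesgue_rV_step.

(* n-dimensional Lebesgue measure, as an iterated product measure *)
Fixpoint lebesgue_rV (R : realType) (n : nat) :
    {sigma_finite_measure set 'rV[R]_n -> \bar R} :=
  match n with
  | 0%N => \d_(0 : 'rV[R]_0)
  | m.+1 => lebesgue_step (lebesgue_rV R m)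
  end.

Lemma lebesgue_rV_box (R : realType) (n : nat) (A : 'I_n -> set R) :
  (forall i, measurable (A i)) ->
  lebesgue_rV R n [set v | forall i, A i (v 0 i)] =
  (\prod_(i < n) lebesgue_measure (A i))%E.
Proof.
elim: n A => [|n IHn] A mA.
  by rewrite big_ord0 /= diracE mem_set//= => -[].
by rewrite big_ord_recl -IHn //=; exact: lebesgue_step_box.
Qed.

Section euclidean.
Context (R : realType) (n : nat).
Implicit Types (x y z : 'rV[R]_n) (Om : set 'rV[R]_n).

(* The library norm of 'rV[R]_n is the sup norm, hence this definition. *)
Definition enorm x : R := Num.sqrt (\sum_i x 0 i ^+ 2).

Definition set_dist Om1 Om2 : R :=
  inf [set enorm (p.1 - p.2) | p in Om1 `*` Om2].

End euclidean.

(* Near each of its boundary points, and in suitable orthonormal coordinates,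
   Om is the strict epigraph of a Lipschitz function of n - 1 variables; the
   distinguished coordinate is j and col' j deletes it. *)
Definition lipschitz_boundary (R : realType) (n : nat) (Om : set 'rV[R]_n) :=
  forall z, (closure Om `\` Om°) z ->
  exists (Q : 'M[R]_n) (j : 'I_n) (g : 'rV[R]_n.-1 -> R) (L r : R),
    [/\ Q *m Q^T = 1%:M, 0 < r,
        forall a b, `|g a - g b| <= L * enorm (a - b) &
        forall x, enorm (x - z) < r ->
          Om x <-> g (col' j (x *m Q)) < (x *m Q) 0 j].

Definition bounded_lipschitz_domain (R : realType) (n : nat)
    (Om : set 'rV[R]_n) :=
  [/\ Om !=set0, open Om, connected Om, bounded_set Om &
      lipschitz_boundary Om].

Section test_functions.
Context (R : realType) (n : nat).
Implicit Types f : 'rV[R]_n -> R.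

Definition iter_partial (l : seq 'I_n) f : 'rV[R]_n -> R :=
  foldr (fun i g => 'D_(delta_mx 0 i) g) f l.

Definition smooth f := forall l : seq 'I_n,
  continuous (iter_partial l f) /\
  forall i x, derivable (iter_partial l f) x (delta_mx 0 i).

(* ordinary (pointwise, not essential) support *)
Definition support_of f : set 'rV[R]_n := closure [set x | f x != 0].

Definition test_function (Om : set 'rV[R]_n) f :=
  [/\ smooth f, compact (support_of f) & support_of f `<=` Om].

End test_functions.

Section fractional_spaces.
Context (R : realType) (n : nat).
Local Notation mu := (lebesgue_rV R n).
Implicit Types (s : R) (v : 'rV[R]_n -> R) (Om : set 'rV[R]_n).

(* |z|^(n + 2 s), which is 0 at z = 0 *)
Definition frac_kernel s (z : 'rV[R]_n) : R := enorm z `^ (n%:R + 2 * s).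

(* [gagliardo s v] is the square of the Gagliardo seminorm of v. *)
Definition gagliardo s v : \bar R :=
  (\int[mu]_x \int[mu]_y (`|v x - v y| ^+ 2 / frac_kernel s (x - y))%:E)%E.

Definition Hs s v := v \in Lfun mu 2%:E /\ (gagliardo s v < +oo)%E.

(* square of the norm of H^s *)
Definition Hs_norm2 s v : \bar R :=
  ((\int[mu]_x (`|v x| ^+ 2)%:E) + gagliardo s v)%E.

Definition tildeHs s Om v :=
  Hs s v /\ forall e : R, 0 < e ->
    exists2 phi, test_function Om phi & (Hs_norm2 s (v \- phi)%R < e%:E)%E.

Definition tildeHs_norm s v : R := Num.sqrt (fine (gagliardo s v)).

(* The constant of (-Delta)^s: the inverse of the integral over R^n of
   (1 - cos z_1) / |z|^(n + 2 s), which makes |xi|^(2 s) the symbol of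
   (-Delta)^s. The inner sum selects the first coordinate of z. *)
Definition frac_laplacian_const s : R :=
  (fine (\int[mu]_z
    ((1 - cos (\sum_(i < n | i == 0%N :> nat) z 0 i)) / frac_kernel s z)%:E)%E)^-1.

End fractional_spaces.

Section coupled_form.
Context (R : realType) (n : nat) (s1 s2 : R) (Om1 Om2 : set 'rV[R]_n).
Local Notation mu := (lebesgue_rV R n).
Local Notation F := ('rV[R]_n -> R).
Implicit Types u v : F.

Definition decomposition u (p : F * F) :=
  [/\ tildeHs s1 Om1 p.1, tildeHs s2 Om2 p.2 & u = p.1 \+ p.2].

Definition spaceH : set F := [set u | exists p, decomposition u p].

(* A decomposition u = u_1 + u_2 of u in H. For disjoint Om1 and Om2 it is
   unique up to a.e. equality, so that which one is chosen is irrelevant. *)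
Definition components u : F * F := xget (cst 0, cst 0) (decomposition u).

Definition normH u : R :=
  Num.sqrt (tildeHs_norm s1 (components u).1 ^+ 2 +
            tildeHs_norm s2 (components u).2 ^+ 2).

(* Extended-real valued, as an integral may fail to converge for u or v
   outside of spaceH. *)
Definition formA (J : F) u v : \bar R :=
  let: (u1, u2) := components u in let: (v1, v2) := components v in
  let C1 := frac_laplacian_const n s1 / 2 in
  let C2 := frac_laplacian_const n s2 / 2 in
  (C1%:E * (\int[mu]_(x in ~` Om2) \int[mu]_(y in ~` Om2)
     ((u1 x - u1 y) * (v1 x - v1 y) / frac_kernel s1 (x - y))%:E) +
   C2%:E * (\int[mu]_(x in ~` Om1) \int[mu]_(y in ~` Om1)
     ((u2 x - u2 y) * (v2 x - v2 y) / frac_kernel s2 (x - y))%:E) +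
   (\int[mu]_(x in Om1) \int[mu]_(y in Om2)
     (J (x - y) * (u1 x - u2 y) * (v1 x - v2 y))%:E))%E.

End coupled_form.

Definition bilinear_on (R : realType) (T : Type) (H : set (T -> R))
    (A : (T -> R) -> (T -> R) -> \bar R) :=
  (forall (a : R) u u' v, H u -> H u' -> H v ->
     A (fun x => a * u x + u' x) v = (a%:E * A u v + A u' v)%E) /\
  (forall (a : R) u v v', H u -> H v -> H v' ->
     A u (fun x => a * v x + v' x) = (a%:E * A u v + A u v')%E).

(* Main.v *)
Require Import Defs.
From mathcomp Require Import all_boot all_order all_algebra.
From mathcomp Require Import all_classical all_reals all_analysis.
From mathcomp Require Import measurable_realfun.
From mathcomp Require Import ring lra.
Import Order.TTheory GRing.Theory Num.Theory.
Import numFieldNormedType.Exports.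
Local Open Scope classical_set_scope.
Local Open Scope ring_scope.

Set Implicit Arguments.
Unset Strict Implicit.
Unset Printing Implicit Defensive.

(** The elements of H are known only through their components, which are
    determined up to null sets, so everything is carried out on pairs (u1, u2)
    of functions with finite Gagliardo seminorm that vanish almost everywhere
    outside of the first, respectively the second, domain.  By Fubini each of
    the three terms of the form is the integral over R^n x R^n of
    w * f * g, where w >= 0 is a weight and f, g depend linearly on the pairs:
    f is u1(x) - u1(y), u2(x) - u2(y) or u1(x) - u2(y).  Hence the sum of the
    three terms is a symmetric nonnegative bilinear form as soon as its
    diagonal is finite, it does not see changes on null sets, and it satisfies
    the Cauchy-Schwarz inequality.  Continuity thus reduces to bounding
    A(v,v) from above by the squared norm, and coercivity is the opposite bound.

    Two estimates carry the proof.  The first is the fractional Poincare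
    inequality [poincare]: if v vanishes outside of O, then comparing v on O
    with v = 0 on a unit cube B that misses both domains already bounds the
    square of the L^2 norm of v, and B lies outside of the other domain, so
    that only the part of the Gagliardo integral present in the form is used.
    The second, [gagliardo_le_outer], recovers the missing part of the
    Gagliardo integral: there one of the two points lies in the other domain,
    at positive distance from O, so that the kernel is bounded and
    the L^2 norm of v controls this part.  Together they make the
    restricted and the full seminorms equivalent ([gagliardo_outer_equiv]),
    which gives coercivity, because the coupling term is nonnegative.  The
    coupling term is at most a multiple of the L^2 norms by a Young type
    computation ([wnorm2_coupling_le]), hence of the seminorms by the Poincare
    inequality.

    Coercivity also requires the constant of the fractional Laplacian to be
    positive, that is, the integral of (1 - cos z_1) / |z|^(n + 2 s) to be
    positive and finite; finiteness is obtained by cutting R^n into dyadic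
    shells, on which the integrals are dominated by a geometric series. *)

(** * Reflection invariance of Lebesgue measure *)

(** The product measure and its image agree on rectangles, which determine a
    product measure. *)
Lemma measure_preserving_pair d1 d2 (T1 : measurableType d1)
    (T2 : measurableType d2) (R : realType)
    (m1 : {sigma_finite_measure set T1 -> \bar R})
    (m2 : {sigma_finite_measure set T2 -> \bar R})
    (f : T1 -> T1) (g : T2 -> T2) :
  measurable_fun setT f -> measurable_fun setT g ->
  (forall A, measurable A -> m1 (f @^-1` A) = m1 A) ->
  (forall A, measurable A -> m2 (g @^-1` A) = m2 A) ->
  forall B, measurable B ->
    (m1 \x m2)%E ((fun p => (f p.1, g p.2)) @^-1` B) = (m1 \x m2)%E B.
Proof.
move=> mf mg f_m1 g_m2 B mB.
have mfg : measurable_fun setT (fun p : T1 * T2 => (f p.1, g p.2)).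
  by apply: measurable_fun_pair; apply: measurableT_comp.
pose nu := measure_function_pushforward__canonical__measure_function_Measure
  (m1 \x m2)%E mfg.
apply/esym/(@product_measure_unique _ _ _ _ _ m1 m2 nu) => //.
move=> A1 A2 mA1 mA2 /=; rewrite /pushforward.
rewrite -[X in _ = (X * _)%E]f_m1// -[X in _ = (_ * X)%E]g_m2//.
rewrite -product_measure1E//; rewrite -[X in measurable X]setTI.
  exact: mf.
exact: mg.
Qed.

Lemma measurable_rVB (R : realType) (n : nat) d (T : measurableType d)
    (f g : T -> 'rV[R]_n) :
  measurable_fun setT f -> measurable_fun setT g ->
  measurable_fun setT (fun t => f t - g t).
Proof.
move=> mf mg; apply: measurable_fun_rV => i.
rewrite (_ : (fun _ => _) = (fun t => f t 0 i - g t 0 i)).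
  by apply: measurable_funB;
    [apply: (measurableT_comp (measurable_coord i) mf)
    |apply: (measurableT_comp (measurable_coord i) mg)].
by apply/funext => t; rewrite !mxE.
Qed.

Lemma lebesgue_measure_reflect (R : realType) (c : R)
    (A : set (measurableTypeR R)) :
  measurable A -> lebesgue_measure ((fun y => c - y) @^-1` A) =
    lebesgue_measure A.
Proof.
have mr : measurable_fun setT (fun y : measurableTypeR R => c - y : measurableTypeR R).
  by apply: measurable_funB => //; exact: measurable_cst.
pose nu := measure_function_pushforward__canonical__measure_function_Measure
  (@lebesgue_measure R) mr.
move=> mA; apply/esym; apply: (@lebesgue_measure_unique R nu) => //.
move=> _ [[a b] _ <-] /=.
rewrite /pushforward.
rewrite (_ : _ @^-1` _ = `[c - b, c - a[%classic); last first.
  apply/seteqP; split => y /=; rewrite !in_itv /=; lra.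
rewrite !lebesgue_measure_itv/= !lte_fin ltrD2l ltrN2.
by case: ifPn => // _; rewrite -!EFinB; congr EFin; ring.
Qed.

(** This single invariance is used for both Young type integrals of the
    coupling term, since y |-> x - y is a reflection for every x; it passes from
    dimension n to n + 1 through the product structure. *)
Lemma lebesgue_rV_reflect (R : realType) (n : nat) (c : 'rV[R]_n)
    (A : set 'rV[R]_n) :
  measurable A -> lebesgue_rV R n ((fun y => c - y) @^-1` A) =
    lebesgue_rV R n A.
Proof.
elim: n c A => [c A mA|n IHn c A mA].
  congr (lebesgue_rV R 0 _); apply/seteqP; split => y /=;
    by rewrite !(thinmx0 _).
rewrite /= /lebesgue_step /pushforward.
pose c' : 'rV[R]_n := \row_i c 0 (lift 0 i).
have mR : measurable_fun setT (fun y : measurableTypeR R => c 0 0 - y).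
  by apply: measurable_funB => //; exact: measurable_cst.
have mR' : measurable_fun setT (fun y : 'rV[R]_n => c' - y).
  by apply: measurable_rVB => //; exact: measurable_cst.
have consB t y : c - rV_cons (t, y) = rV_cons (c 0 0 - t, c' - y).
  by apply/rowP => i; rewrite !mxE/=; case: unliftP => [j|] -> //; rewrite !mxE.
rewrite -[RHS](measure_preserving_pair mR mR').
- congr (_ _); apply/seteqP; split => -[t y] /=; rewrite consB //.
- by move=> B mB; exact: (lebesgue_measure_reflect (c 0 0) mB).
- by move=> B mB; exact: IHn.
- by rewrite -[X in measurable X]setTI; exact: measurable_rV_cons.
Qed.

Lemma ge0_integral_rV_reflect (R : realType) (n : nat) (c : 'rV[R]_n)
    (f : 'rV[R]_n -> \bar R) :
  measurable_fun setT f -> (forall y, 0 <= f y)%E ->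
  (\int[lebesgue_rV R n]_y f (c - y)%R = \int[lebesgue_rV R n]_y f y)%E.
Proof.
move=> mf f0.
have mr : measurable_fun setT (fun y : 'rV[R]_n => c - y).
  by apply: measurable_rVB => //; exact: measurable_cst.
rewrite -(ge0_integral_pushforward mr _ measurableT) //.
by apply: (eq_measure_integral (lebesgue_rV R n)) => A mA _;
  exact: lebesgue_rV_reflect.
Qed.

(** * Weighted quadratic forms *)

Section weighted_form.
Local Open Scope ereal_scope.
Context d (T : measurableType d) (R : realType) (m : {measure set T -> \bar R}).
Implicit Types (w f g h : T -> R) (a : R).

(** The general symmetric form behind the three terms of A: [wform w] is the
    inner product of L^2(w m), [wnorm2] its squared norm, extended-real valued
    so that it makes sense before finiteness is known. *)
Definition wform w f g : R := (\int[m]_z (w z * f z * g z))%R.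

Definition wnorm2 w f : \bar R := \int[m]_z (w z * f z ^+ 2)%:E.

Definition wL2 w : set (T -> R) :=
  [set f | measurable_fun setT f /\ wnorm2 w f < +oo].

Lemma measurable_wnorm2 w f : measurable_fun setT w -> measurable_fun setT f ->
  measurable_fun setT (fun z => (w z * f z ^+ 2)%:E).
Proof.
move=> mw mf; apply/measurable_EFinP; apply: measurable_funM => //.
exact: measurable_funX.
Qed.

Lemma measurable_wform w f g : measurable_fun setT w ->
  measurable_fun setT f -> measurable_fun setT g ->
  measurable_fun setT (fun z => w z * f z * g z)%R.
Proof. by move=> mw mf mg; do 2 apply: measurable_funM => //. Qed.

Section weight.
Variable w : T -> R.
Hypotheses (mw : measurable_fun setT w) (w0 : forall z, (0 <= w z)%R).

Lemma wnorm2_ge0 f : 0 <= wnorm2 w f.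
Proof. by apply: integral_ge0 => z _; rewrite lee_fin mulr_ge0 ?sqr_ge0. Qed.

(** From (x + y)^2 <= 2 x^2 + 2 y^2; this crude form of the triangle inequality
    is all that stability under linear combinations needs. *)
Lemma wnorm2_lin a f g : measurable_fun setT f -> measurable_fun setT g ->
  wnorm2 w (fun z => a * f z + g z)%R <=
    (2 * a ^+ 2)%:E * wnorm2 w f + 2%:E * wnorm2 w g.
Proof.
move=> mf mg; have mafg : measurable_fun setT (fun z => a * f z + g z)%R.
  by apply: measurable_funD => //; exact: measurable_funM.
rewrite /wnorm2 -!ge0_integralZl//; last first.
- by rewrite lee_fin mulr_ge0// sqr_ge0.
- by move=> z _; rewrite lee_fin mulr_ge0 ?sqr_ge0.
- exact: measurable_wnorm2.
- by move=> z _; rewrite lee_fin mulr_ge0 ?sqr_ge0.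
- exact: measurable_wnorm2.
have m1 h b : measurable_fun setT h ->
    measurable_fun setT (fun z => b%:E * (w z * h z ^+ 2)%:E).
  by move=> mh; apply: measurable_funeM; exact: measurable_wnorm2.
have p1 h b z : (0 <= b)%R -> 0 <= b%:E * (w z * h z ^+ 2)%:E.
  by move=> b0; rewrite -EFinM lee_fin mulr_ge0// mulr_ge0 ?sqr_ge0.
have a0 : (0 <= 2 * a ^+ 2)%R by rewrite mulr_ge0// sqr_ge0.
rewrite -ge0_integralD//; try by move=> z _; exact: p1.
- apply: ge0_le_integral => //.
  + by move=> z _; rewrite lee_fin mulr_ge0 ?sqr_ge0.
  + exact: measurable_wnorm2.
  + by apply: emeasurable_funD; exact: m1.
  + move=> z _; rewrite -!EFinM -EFinD lee_fin.
    have := sqr_ge0 (a * f z - g z)%R.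
    move: (w z) (w0 z) (f z) (g z) => t t0 x y H.
    rewrite -subr_ge0.
    rewrite (_ : (_ - _ = t * (a * x - y) ^+ 2)%R); first by rewrite mulr_ge0.
    by ring.
- exact: m1.
- exact: m1.
Qed.

Lemma wL2_lin a f g : wL2 w f -> wL2 w g -> wL2 w (fun z => a * f z + g z)%R.
Proof.
move=> [mf foo] [mg goo]; split.
  by apply: measurable_funD => //; exact: measurable_funM.
apply: le_lt_trans (wnorm2_lin _ _ _) _ => //.
rewrite lte_add_pinfty//; apply: lte_mul_pinfty => //.
by rewrite lee_fin mulr_ge0 ?sqr_ge0.
Qed.

Lemma wL2_integrable_sqr f : wL2 w f ->
  m.-integrable setT (EFin \o (fun z => w z * f z ^+ 2)%R).
Proof.
move=> [mf foo]; apply/integrableP; split; first exact: measurable_wnorm2.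
rewrite (eq_integral (fun z => (w z * f z ^+ 2)%:E)) // => z _ /=.
by rewrite ger0_norm// mulr_ge0 ?sqr_ge0.
Qed.

(** From 2 |f g| <= f^2 + g^2: square integrability suffices for the form to be
    finite off the diagonal. *)
Lemma wL2_integrable f g : wL2 w f -> wL2 w g ->
  m.-integrable setT (EFin \o (fun z => w z * f z * g z)%R).
Proof.
move=> fL gL; have [mf _] := fL; have [mg _] := gL.
apply: (@le_integrable _ _ _ _ _ measurableT _
  (EFin \o (fun z => w z * f z ^+ 2 + w z * g z ^+ 2)%R)).
- by apply/measurable_EFinP; exact: measurable_wform.
- move=> z _ /=; rewrite lee_fin -mulrA -mulrDr !normrM (ger0_norm (w0 z)).
  rewrite ler_wpM2l// (@ger0_norm _ (_ + _)) ?addr_ge0 ?sqr_ge0//.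
  rewrite -(real_normK (num_real (f z))) -(real_normK (num_real (g z))).
  by have := sqr_ge0 (`|f z| - `|g z|)%R;
    have := normr_ge0 (f z); have := normr_ge0 (g z); nra.
- rewrite (_ : _ \o _ = (EFin \o (fun z => w z * f z ^+ 2)%R) \+
    (EFin \o (fun z => w z * g z ^+ 2)%R)); last by apply/funext => z.
  by apply: integrableD => //; exact: wL2_integrable_sqr.
Qed.

Lemma wformC f g : wform w f g = wform w g f.
Proof. by apply: eq_Rintegral => z _; rewrite mulrAC. Qed.

Lemma wform_linl a f g h : wL2 w f -> wL2 w g -> wL2 w h ->
  wform w (fun z => a * f z + g z)%R h = (a * wform w f h + wform w g h)%R.
Proof.
move=> fL gL hL; rewrite /wform -RintegralZl//; last exact: wL2_integrable.
rewrite -RintegralD//; last first.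
- exact: wL2_integrable.
- rewrite (_ : _ \o _ = fun z => a%:E * (w z * f z * h z)%:E)//.
  by apply: integrableZl => //; exact: wL2_integrable.
by apply: eq_Rintegral => z _; ring.
Qed.

Lemma wform_ge0 f : (0 <= wform w f f)%R.
Proof.
by apply: Rintegral_ge0 => z _; rewrite -mulrA -expr2 mulr_ge0 ?sqr_ge0.
Qed.

Lemma EFin_wform f : wL2 w f -> (wform w f f)%:E = wnorm2 w f.
Proof.
move=> fL; rewrite /wform /Rintegral fineK.
  by apply: eq_integral => z _; rewrite -mulrA -expr2.
by apply: integrable_fin_num => //; exact: wL2_integrable.
Qed.

End weight.

(** The weight may change on a null set too: the coupling weight is built from
    the absolute value of J, which agrees with J almost everywhere only. *)
Lemma ae_eq_wform w w' f f' g g' :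
  measurable_fun setT w -> measurable_fun setT w' ->
  measurable_fun setT f -> measurable_fun setT f' ->
  measurable_fun setT g -> measurable_fun setT g' ->
  ae_eq m setT w w' -> ae_eq m setT f f' -> ae_eq m setT g g' ->
  \int[m]_z (w z * f z * g z)%:E = \int[m]_z (w' z * f' z * g' z)%:E.
Proof.
move=> mw mw' mf mf' mg mg' ww' ff' gg'; apply: ae_eq_integral => //.
- by apply/measurable_EFinP; exact: measurable_wform.
- by apply/measurable_EFinP; exact: measurable_wform.
- by apply: filterS3 ww' ff' gg' => z ww' ff' gg' _; rewrite ww'// ff'// gg'.
Qed.

Lemma ae_eq_wnorm2 w f f' : measurable_fun setT w ->
  measurable_fun setT f -> measurable_fun setT f' ->
  ae_eq m setT f f' -> wnorm2 w f = wnorm2 w f'.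
Proof.
move=> mw mf mf' ff'; rewrite /wnorm2.
under eq_integral do rewrite expr2 mulrA.
rewrite (@ae_eq_wform w w f f' f f')//.
  by apply: eq_integral => z _; rewrite expr2 mulrA.
exact/aeW.
Qed.

End weighted_form.

(** * Euclidean norm, fractional kernel and cubes *)

Section enorm_theory.
Context (R : realType) (n : nat).
Implicit Types (x z : 'rV[R]_n) (r s : R).

Lemma rV_normP z r : 0 <= r -> (`|z| <= r) <-> (forall i, `|z 0 i| <= r).
Proof.
move=> r0; rewrite {1}/Num.norm /= mx_normrE; split.
  by move=> /bigmax_leP[_ H] i; exact: (H (0, i)).
by move=> H; apply/bigmax_leP; split => // -[i j] _ /=; rewrite (ord1 i).
Qed.

Lemma enorm_ge0 z : 0 <= enorm z.
Proof. exact: sqrtr_ge0. Qed.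

Lemma enormN z : enorm (- z) = enorm z.
Proof. by congr Num.sqrt; apply: eq_bigr => i _; rewrite mxE sqrrN. Qed.

Lemma coord_le_norm z i : `|z 0 i| <= `|z|.
Proof. exact: ((rV_normP z (normr_ge0 z)).1 (lexx _) i). Qed.

Lemma norm_le_enorm z : `|z| <= enorm z.
Proof.
apply/(rV_normP _ (enorm_ge0 z)) => i.
rewrite -sqrtr_sqr ler_wsqrtr// (bigD1 i)//= lerDl.
by apply: sumr_ge0 => j _; exact: sqr_ge0.
Qed.

Lemma enorm_le_norm z : enorm z <= n%:R * `|z|.
Proof.
rewrite -[leRHS]ger0_norm ?mulr_ge0// -sqrtr_sqr ler_wsqrtr//.
apply: (@le_trans _ _ (\sum_(i < n) `|z| ^+ 2)).
  by apply: ler_sum => i _; rewrite -real_normK ?num_real// lerXn2r ?nnegrE// coord_le_norm.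
rewrite sumr_const card_ord exprMn -[X in X <= _]mulr_natl ler_wpM2r ?sqr_ge0//.
by case: n => [|k]; rewrite ?expr0n// expr2 -[X in X <= _]mulr1 ler_wpM2l// ler1n.
Qed.

Lemma measurable_enorm : measurable_fun setT (@enorm R n).
Proof.
apply: (measurableT_comp (@continuous_measurable_fun _ _ (@sqrt_continuous R))).
under eq_fun do rewrite -big_enum.
apply: measurable_sum => i; apply: measurable_funX; exact: measurable_coord.
Qed.

Lemma frac_kernel_ge0 s z : 0 <= frac_kernel s z.
Proof. exact: powR_ge0. Qed.

Lemma frac_kernelN s z : frac_kernel s (- z) = frac_kernel s z.
Proof. by rewrite /frac_kernel enormN. Qed.

Lemma measurable_frac_kernelV s :
  measurable_fun setT (fun z : 'rV[R]_n => (frac_kernel s z)^-1).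
Proof.
rewrite (_ : (fun _ => _) =
  (fun t => powR t (- (n%:R + 2 * s))) \o @enorm R n); last first.
  by apply/funext => z /=; rewrite powRN.
apply: measurableT_comp; [exact: measurable_powR|exact: measurable_enorm].
Qed.

(** The kernel is measured with the Euclidean norm and the sets below with the
    sup norm, which is smaller than the Euclidean one and at least 1/n times it;
    this and the next lemma convert bounds on the latter. *)
Lemma frac_kernelV_le s z r : 0 <= s -> 0 < r -> r <= `|z| ->
  (frac_kernel s z)^-1 <= (r `^ (n%:R + 2 * s))^-1.
Proof.
move=> s0 r0 rz; have rze := le_trans rz (norm_le_enorm z).
rewrite lef_pV2 ?posrE ?powR_gt0//; last exact: lt_le_trans rze.
by rewrite ge0_ler_powR ?nnegrE ?addr_ge0 ?mulr_ge0 ?enorm_ge0// ltW.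
Qed.

Lemma frac_kernelV_ge s z r : 0 <= s -> z != 0 -> n%:R * `|z| <= r ->
  (r `^ (n%:R + 2 * s))^-1 <= (frac_kernel s z)^-1.
Proof.
move=> s0 z0 zr; have zre := le_trans (enorm_le_norm z) zr.
have e0 : 0 < enorm z by rewrite (lt_le_trans _ (norm_le_enorm z))// normr_gt0.
rewrite lef_pV2 ?posrE ?powR_gt0//; last exact: lt_le_trans zre.
by rewrite ge0_ler_powR ?nnegrE ?addr_ge0 ?mulr_ge0 ?enorm_ge0// (le_trans (ltW e0)).
Qed.

Lemma lebesgue_rV_itv (a b : R) : a <= b ->
  lebesgue_rV R n [set v | forall i, `[a, b]%classic (v 0 i)] =
    ((b - a) ^+ n)%:E.
Proof.
move=> ab; rewrite (@lebesgue_rV_box R n (fun=> `[a, b]%classic))//.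
rewrite (eq_bigr (fun=> (b - a)%:E)) => [|i _]; last first.
  rewrite lebesgue_measure_itv/= lte_fin; case: ltgtP ab => // ->.
  by rewrite subrr.
by rewrite prodEFin prodr_const card_ord.
Qed.

Lemma measurable_rV_itv (a b : R) :
  measurable [set v : 'rV[R]_n | forall i, `[a, b]%classic (v 0 i)].
Proof.
rewrite (_ : [set _ | _] = \bigcap_(i in [set: 'I_n])
    ((fun v : 'rV[R]_n => v 0 i) @^-1` `[a, b]%classic)).
  apply: fin_bigcap_measurable => // i _.
  by rewrite -[X in measurable X]setTI; apply: measurable_coord.
by apply/seteqP; split => [v H i _|v H i]; [exact: H|exact: (H i I)].
Qed.

Lemma cubeE r : 0 <= r ->
  [set v : 'rV[R]_n | forall i, `[- r, r]%classic (v 0 i)] =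
  [set v : 'rV[R]_n | `|v| <= r].
Proof.
move=> r0; apply/seteqP; split => v /= H.
  by apply/rV_normP => // i; rewrite ler_norml; have := H i; rewrite /= in_itv.
by move=> i; rewrite in_itv /= -ler_norml; exact: ((rV_normP v r0).1 H i).
Qed.

Lemma measurable_cube r : 0 <= r -> measurable [set v : 'rV[R]_n | `|v| <= r].
Proof. by move=> r0; rewrite -cubeE//; exact: measurable_rV_itv. Qed.

Lemma lebesgue_rV_cube r : 0 <= r ->
  lebesgue_rV R n [set v : 'rV[R]_n | `|v| <= r] = ((2 * r) ^+ n)%:E.
Proof.
move=> r0; rewrite -cubeE// lebesgue_rV_itv; last by lra.
by rewrite opprK -mulr2n mulr_natl.
Qed.

End enorm_theory.

(** * Integration over dyadic shells *)

(** A function bounded by [a k] on a set [E k] for some k is dominated by the sum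
    of the step functions a_k 1_{E_k}, whose integrals form a geometric series. *)
Lemma ge0_integral_shells_lty d (T : measurableType d) (R : realType)
    (m : {measure set T -> \bar R}) (D : set T) (f : T -> R)
    (E : nat -> set T) (a : nat -> R) (C q : R) :
  measurable D -> measurable_fun D f -> (forall x, 0 <= f x) ->
  (forall k, measurable (E k)) -> (forall k, 0 <= a k) ->
  0 <= C -> 0 < q < 1 ->
  (forall k, (a k)%:E * m (E k) <= (C * q ^+ k)%:E)%E ->
  (forall x, D x -> exists2 k, E k x & f x <= a k) ->
  (\int[m]_(x in D) (f x)%:E < +oo)%E.
Proof.
move=> mD mf f0 mE a0 C0 /andP[q0 q1] aE fE.
pose g k x := (a k * \1_(E k) x)%:E.
have g0 k x : (0 <= g k x)%E by rewrite lee_fin mulr_ge0.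
have mg k : measurable_fun D (g k).
  by apply/measurable_EFinP; apply: measurable_funM => //; exact: measurable_indic.
apply: (@le_lt_trans _ _ (\int[m]_(x in D) (\sum_(0 <= k <oo) g k x))%E).
  apply: ge0_le_integral => //.
  - by move=> x _; rewrite lee_fin.
  - exact/measurable_EFinP.
  - by apply: ge0_emeasurable_sum => // k x _ _.
  - move=> x Dx; have [k Ekx fak] := fE x Dx.
    apply: le_trans; last by apply: (nneseries_lim_ge k.+1) => i _ _; exact: g0.
    rewrite big_nat_recr//=; apply: (@le_trans _ _ (g k x)).
      by rewrite /g indicE mem_set// mulr1 lee_fin.
    by rewrite leeDr//; apply: sume_ge0 => i _.
rewrite integral_nneseries//.
apply: (@le_lt_trans _ _ (C / (1 - q))%:E); last exact: ltry.
apply: lime_le.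
  by apply: is_cvg_nneseries => k _ _; apply: integral_ge0 => x _; exact: g0.
near=> N; apply: (@le_trans _ _ (\sum_(0 <= k < N) (C * q ^+ k)%:E)%E).
  apply: lee_sum => k _; apply: le_trans (aE k).
  rewrite /g; under eq_integral do rewrite EFinM.
  rewrite ge0_integralZl//; last 2 first.
  - by apply/measurable_EFinP; exact: measurable_indic.
  - by rewrite lee_fin.
  rewrite lee_wpmul2l ?lee_fin// integral_indic//.
  by apply: le_measure; rewrite ?inE//; exact: measurableI.
rewrite sumEFin lee_fin; have := @geometric_le_lim R N C q C0 q0.
by rewrite ger0_norm ?(ltW q0)//; apply.
Unshelve. all: by end_near. Qed.

Section frac_laplacian.
Context (R : realType).

Lemma cos_ge_quadratic (x : R) : 1 - cos x <= x ^+ 2.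
Proof.
wlog x0 : x / 0 <= x.
  move=> H; have [/H//|x0] := leP 0 x.
  by rewrite -cosN -sqrrN; apply: H; rewrite oppr_ge0 ltW.
have [->|xneq0] := eqVneq x 0; first by rewrite cos0 subrr expr0n.
have xgt0 : 0 < x by rewrite lt0r xneq0.
have dcos (c : R) : is_derive c 1 (@cos R) (- sin c) by exact: is_derive_cos.
have dsin (c : R) : is_derive c 1 (@sin R) (cos c) by exact: is_derive_sin.
have ccos (y z : R) : {within `[y, z], continuous (@cos R)}.
  by apply: continuous_subspaceT => t; exact: continuous_cos.
have csin (y z : R) : {within `[y, z], continuous (@sin R)}.
  by apply: continuous_subspaceT => t; exact: continuous_sin.
have [c] := @MVT R (@cos R) (fun c => - sin c) _ _ xgt0 (fun c _ => dcos c) (ccos 0 x).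
rewrite in_itv /= subr0 cos0 => /andP[c0 cx] cosx.
have [e] := @MVT R (@sin R) (@cos R) _ _ c0 (fun c _ => dsin c) (csin 0 c).
rewrite in_itv /= subr0 sin0 subr0 => /andP[e0 ec] sinc.
have -> : 1 - cos x = cos e * (c * x) by rewrite -opprB cosx sinc; ring.
apply: (@le_trans _ _ (1 * (c * x))).
  by rewrite ler_wpM2r ?cos_le1// mulr_ge0// ltW.
by rewrite mul1r expr2 ler_wpM2r// ltW.
Qed.

Lemma dyadic_shell (r : R) : 1 <= r ->
  exists k, 2 ^+ k <= r < 2 ^+ k.+1.
Proof.
move=> r1; have exk : exists k, r < 2 ^+ k.
  exists (Num.bound r); apply: lt_le_trans (archi_boundP (le_trans ler01 r1)) _.
  by rewrite -natrX ler_nat ltnW// ltn_expl.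
case: (ex_minnP exk) => -[|k]; first by rewrite expr0 ltNge r1.
move=> rk kmin; exists k; rewrite rk andbT leNgt; apply/negP => /kmin.
by rewrite ltnn.
Qed.

End frac_laplacian.

(** * Positivity of the constant of the fractional Laplacian *)

Section frac_laplacian_const_gt0.
Context (R : realType).
Implicit Types (x : R).

Lemma powR2_gt1 x : 0 < x -> 1 < 2 `^ x.
Proof.
move=> x0; rewrite /powR pnatr_eq0/= expR_gt1 mulr_gt0//.
by rewrite ln_gt0// ltr1n.
Qed.

Lemma powRX2 k x : (2 ^+ k) `^ x = (2 `^ x) ^+ k.
Proof. by rewrite -powR_mulrn// powRAC powR_mulrn// powR_ge0. Qed.

Lemma invr_powR (t : R) x : 0 <= t -> t^-1 `^ x = (t `^ x)^-1.
Proof. by move=> t0; rewrite -powR_inv1// powRAC powR_inv1// powR_ge0. Qed.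

Variables (n : nat) (s : R) (i0 : 'I_n).
Hypothesis s01 : 0 < s < 1.
Let s0 : 0 < s. Proof. by case/andP: s01. Qed.
Let p := n%:R + 2 * s.

Let h (z : 'rV[R]_n) : R := (1 - cos (z 0 i0)) / frac_kernel s z.

Let h_ge0 z : 0 <= h z.
Proof. by rewrite divr_ge0 ?frac_kernel_ge0// subr_ge0 cos_le1. Qed.

Let measurable_h : measurable_fun setT h.
Proof.
apply: measurable_funM; last exact: measurable_frac_kernelV.
apply: measurable_funB; first exact: measurable_cst.
apply: (measurableT_comp (continuous_measurable_fun (@continuous_cos R))).
exact: measurable_coord.
Qed.

Let powRp (t : R) : 0 < t -> t `^ p = t ^+ n * t `^ (2 * s).
Proof.
move=> t0; rewrite powRD; last by rewrite (gt_eqF t0) implybT.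
by rewrite powR_mulrn// ltW.
Qed.

(** Away from the origin 1 - cos <= 2, and on the shell 2^k <= |z| < 2^(k+1) the
    integral is at most a constant times 2^(-2 s k), because the volume
    compensates the power n of the kernel. *)
Let h_outer_lty :
  (\int[lebesgue_rV R n]_(z in ~` [set z | (`|z| <= 1)%R]) (h z)%:E < +oo)%E.
Proof.
pose E k := [set z : 'rV[R]_n | `|z| <= 2 ^+ k.+1].
pose a k := 2 * ((2 ^+ k) `^ p)^-1 : R.
apply: (@ge0_integral_shells_lty _ _ _ _ _ h E a (2 * 4 ^+ n)
  (2 `^ (2 * s))^-1) => //.
- by apply: measurableC; exact: measurable_cube.
- exact: measurable_funTS.
- by move=> k; apply: measurable_cube.
- by move=> k; rewrite mulr_ge0// invr_ge0 powR_ge0.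
- by rewrite invr_gt0 powR_gt0//= invf_lt1 ?powR_gt0// powR2_gt1// mulr_gt0.
- move=> k; rewrite [X in (_ * X)%E](_ : _ = ((2 * 2 ^+ k.+1) ^+ n)%:E); last first.
    exact: lebesgue_rV_cube.
  rewrite -EFinM lee_fin /a powRp//.
  rewrite exprVn -powRX2 le_eqVlt; apply/orP; left; apply/eqP.
  have T0 : 0 < 2 ^+ k :> R by rewrite exprn_gt0.
  have U0 : 0 < (2 ^+ k) `^ (2 * s) :> R by rewrite powR_gt0.
  rewrite exprS; move: (2 ^+ k) T0 ((2 ^+ k) `^ (2 * s)) U0 => T T0 U U0.
  rewrite mulrA !exprMn (_ : 4 = 2 * 2 :> R) ?exprMn//; last by ring.
  by field; rewrite !gt_eqF// exprn_gt0.
- move=> z /= /negP; rewrite -ltNge => z1.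
  have [k /andP[kz zk]] := dyadic_shell (ltW z1).
  exists k; first exact: ltW.
  apply: ler_pM; rewrite ?subr_ge0 ?cos_le1 ?invr_ge0 ?frac_kernel_ge0//.
    by have := cos_geN1 (z 0 i0); lra.
  by apply: frac_kernelV_le => //; exact: ltW.
Qed.

(** Near the origin 1 - cos t <= t^2, and the shell 2^(-k-1) < |z| <= 2^(-k)
    contributes at most a constant times 2^(-(2 - 2 s) k). *)
Let h_inner_lty :
  (\int[lebesgue_rV R n]_(z in [set z | (`|z| <= 1)%R]) (h z)%:E < +oo)%E.
Proof.
pose E k := [set z : 'rV[R]_n | `|z| <= (2 ^+ k)^-1].
pose a k := (2 ^+ k) ^- 2 * (2 ^+ k.+1) `^ p : R.
apply: (@ge0_integral_shells_lty _ _ _ _ _ h E a (2 ^+ n * 2 `^ p)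
  (2 `^ (2 * s) / 4)) => //.
- exact: measurable_cube.
- exact: measurable_funTS.
- by move=> k; apply: measurable_cube; rewrite invr_ge0.
- by move=> k; rewrite mulr_ge0 ?invr_ge0 ?powR_ge0.
- rewrite divr_gt0 ?powR_gt0//= ltr_pdivrMr// mul1r.
  (* The ratio 2^(2 s) / 4 = 2^(2 s - 2) is smaller than 1 because s < 1. *)
  have -> : 4 = 2 `^ (2 * s) * 2 `^ (2 - 2 * s) :> R.
    rewrite -powRD; last by rewrite pnatr_eq0 implybT.
    by rewrite addrCA subrr addr0 powR_mulrn//; ring.
  rewrite ltr_pMr ?powR_gt0// powR2_gt1//.
  by case/andP: s01; lra.
- move=> k; rewrite [X in (_ * X)%E](_ : _ = ((2 * (2 ^+ k)^-1) ^+ n)%:E); last first.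
    by apply: lebesgue_rV_cube; rewrite invr_ge0.
  rewrite -EFinM lee_fin /a.
  rewrite (exprS 2 k) powRM// (powRp (exprn_gt0 _ _))//.
  rewrite (exprMn k (2 `^ (2 * s))) exprVn -powRX2.
  rewrite (_ : 4 ^+ k = (2 ^+ k) ^+ 2 :> R); last first.
    by rewrite exprAC; congr (_ ^+ _); ring.
  rewrite le_eqVlt; apply/orP; left; apply/eqP.
  have T0 : 0 < 2 ^+ k :> R by rewrite exprn_gt0.
  move: (2 ^+ k) T0 => T T0; rewrite exprMn exprVn.
  by field; rewrite !gt_eqF// exprn_gt0.
- move=> z /= z1; have [->|z0] := eqVneq z 0.
    exists 0%N; first by rewrite /E /= normr0 invr_ge0.
    by rewrite /h mxE cos0 subrr mul0r mulr_ge0 ?invr_ge0 ?powR_ge0.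
  have z0' : 0 < `|z| by rewrite normr_gt0.
  have [|k /andP[kz zk]] := @dyadic_shell R `|z|^-1; first by rewrite invf_ge1.
  exists k; first by rewrite /E /= -[leLHS]invrK lef_pV2 ?posrE ?invr_gt0 ?exprn_gt0.
  apply: ler_pM; rewrite ?subr_ge0 ?cos_le1 ?invr_ge0 ?frac_kernel_ge0//.
    apply: (le_trans (cos_ge_quadratic _)).
    rewrite -real_normK ?num_real// -exprVn lerXn2r ?nnegrE ?invr_ge0//.
    apply: (le_trans (coord_le_norm _ _)).
    by rewrite -[leLHS]invrK lef_pV2 ?posrE ?invr_gt0 ?exprn_gt0.
  rewrite -[leRHS]invrK -invr_powR ?exprn_ge0//; apply: frac_kernelV_le.
  - exact: ltW.
  - by rewrite invr_gt0 exprn_gt0.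
  - by rewrite -[leRHS]invrK lef_pV2 ?posrE ?invr_gt0 ?exprn_gt0// ltW.
Qed.

Let integral_h_lty : (\int[lebesgue_rV R n]_z (h z)%:E < +oo)%E.
Proof.
have mC : measurable [set z : 'rV[R]_n | `|z| <= 1] by exact: measurable_cube.
rewrite -(setUv [set z : 'rV[R]_n | `|z| <= 1]) ge0_integral_setU//.
- exact: lte_add_pinfty.
- exact: measurableC.
- by rewrite setUv; exact/measurable_EFinP.
- by move=> z _; rewrite lee_fin.
- by apply/disj_setPS => z [/= ? []].
Qed.

(** On the cube [1, 2]^n the integrand has a positive lower bound, as cos is
    smaller than 1 on [1, 2]. *)
Let integral_h_gt0 : (0 < \int[lebesgue_rV R n]_z (h z)%:E)%E.
Proof.
pose D := [set v : 'rV[R]_n | forall i, `[1, 2]%classic (v 0 i)].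
have mD : measurable D by exact: measurable_rV_itv.
have n0 : 0 < n%:R :> R by rewrite ltr0n; case: (n) i0 => // -[].
pose c : R := (1 - cos 1) / (n%:R * 2) `^ p.
have cos1 : cos 1 < 1 :> R.
  have pi2 : 2 <= pi :> R by exact: pi_ge2.
  by rewrite -[ltRHS]cos0 ltr_cos ?in_itv/= ?lexx ?ler01/=//; lra.
have c0 : 0 < c by rewrite divr_gt0 ?subr_gt0// powR_gt0// mulr_gt0.
apply: (@lt_le_trans _ _ (\int[lebesgue_rV R n]_(z in D) c%:E)%E).
  rewrite integral_cst// [X in (_ * X)%E](_ : _ = ((2 - 1) ^+ n)%:E); last first.
    by apply: lebesgue_rV_itv; rewrite ler1n.
  rewrite mule_gt0// lte_fin.
apply: (@le_trans _ _ (\int[lebesgue_rV R n]_(z in D) (h z)%:E)%E).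
  apply: ge0_le_integral => //.
  - by move=> z _; rewrite lee_fin ltW.
  - by apply/measurable_EFinP; exact: measurable_funTS.
  move=> z Dz; rewrite lee_fin; apply: ler_pM.
  - by rewrite subr_ge0 cos_le1.
  - by rewrite invr_ge0 powR_ge0.
  - rewrite lerD2l lerN2; have := Dz i0; rewrite /= in_itv/= => /andP[z1 z2].
    have pi2 : 2 <= pi :> R by exact: pi_ge2.
    by rewrite leNgt ltr_cos ?in_itv/= -?leNgt//; apply/andP; split; lra.
  - apply: frac_kernelV_ge; first exact: ltW.
      by apply/eqP => z0; have := Dz i0; rewrite z0 /= mxE in_itv/= ler10.
    rewrite ler_wpM2l//; apply/(rV_normP z (ler0n R 2)) => i.
    have := Dz i; rewrite /= in_itv/= => /andP[z1 z2].
    by rewrite ger0_norm//; lra.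
apply: ge0_subset_integral => //; first exact/measurable_EFinP.
by move=> z _; rewrite lee_fin.
Qed.

Lemma frac_laplacian_const_gt0 : i0 = 0%N :> nat ->
  0 < frac_laplacian_const n s.
Proof.
move=> i00; rewrite /frac_laplacian_const invr_gt0.
rewrite (eq_integral (EFin \o h)) => [|z _]; last first.
  by rewrite (big_pred1 i0)// => i /=; rewrite -i00; apply/eqP/eqP => [/val_inj|->].
by apply: fine_gt0; rewrite integral_h_gt0 integral_h_lty.
Qed.

End frac_laplacian_const_gt0.

(** * Integration on pairs of points *)

Section product_integrals.
Local Open Scope ereal_scope.
Context d1 d2 (T1 : measurableType d1) (T2 : measurableType d2) (R : realType).
Variables (m1 : {sigma_finite_measure set T1 -> \bar R})
          (m2 : {sigma_finite_measure set T2 -> \bar R}).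
Local Notation m := (m1 \x m2).

Lemma ae_fst (P : T1 -> Prop) :
  {ae m1, forall x, P x} -> {ae m, forall z : T1 * T2, P z.1}.
Proof.
move=> [A [mA A0 PA]]; exists (A `*` setT); split.
- exact: measurableX.
- rewrite product_measure1E// [X in X * _](_ : _ = 0) ?mul0e//.
- by move=> z /= Pz; split => //; exact: PA.
Qed.

Lemma ae_snd (P : T2 -> Prop) :
  {ae m2, forall x, P x} -> {ae m, forall z : T1 * T2, P z.2}.
Proof.
move=> [A [mA A0 PA]]; exists (setT `*` A); split.
- exact: measurableX.
- rewrite product_measure1E// [X in _ * X](_ : _ = 0) ?mule0//.
- by move=> z /= Pz; split => //; exact: PA.
Qed.

Lemma ge0_integral_prod (f : T1 -> R) (g : T2 -> R) :
  measurable_fun setT f -> measurable_fun setT g ->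
  (forall x, (0 <= f x)%R) -> (forall y, (0 <= g y)%R) ->
  \int[m]_z (f z.1 * g z.2)%:E =
    (\int[m1]_x (f x)%:E) * (\int[m2]_y (g y)%:E).
Proof.
move=> mf mg f0 g0.
have fge0 x : 0 <= (f x)%:E by rewrite lee_fin.
have gge0 x : 0 <= (g x)%:E by rewrite lee_fin.
rewrite fubini_tonelli1/=; last 2 first.
- apply/measurable_EFinP; apply: measurable_funM;
    exact: measurableT_comp.
- by move=> z; rewrite lee_fin mulr_ge0.
rewrite /fubini_F -ge0_integralZr//; [|exact/measurable_EFinP|]; last first.
  by apply: integral_ge0 => y _.
apply: eq_integral => x _; rewrite -ge0_integralZl//.
exact/measurable_EFinP.
Qed.

Lemma integral_rectangle (A : set T1) (B : set T2) (f : T1 * T2 -> R) :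
  measurable A -> measurable B ->
  m.-integrable setT (EFin \o (fun z => \1_A z.1 * \1_B z.2 * f z)%R) ->
  \int[m1]_(x in A) \int[m2]_(y in B) (f (x, y))%:E =
  \int[m]_z (\1_A z.1 * \1_B z.2 * f z)%:E.
Proof.
move=> mA mB intf; rewrite -(integral12_prod_meas1 intf) integral_mkcond.
apply: eq_integral => x _; rewrite patchE /=; case: ifPn => xA.
  rewrite integral_mkcond; apply: eq_integral => y _ /=; rewrite patchE.
  rewrite !indicE xA mul1r; case: ifPn => yB; rewrite ?mul1r ?mul0r//.
rewrite /fubini_F integral0_eq// => y _ /=.
by rewrite indicE (negbTE xA) !mul0r.
Qed.

End product_integrals.

Section pairs.
Context (R : realType) (n : nat).
Local Notation T := 'rV[R]_n.
Local Notation mu := (lebesgue_rV R n).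
Local Notation m := (mu \x mu)%E.
Implicit Types (v : T -> R) (s : R) (O : set T).

Definition rdiff v (z : T * T) : R := v z.1 - v z.2.

Definition frac_weight s (z : T * T) : R := (frac_kernel s (z.1 - z.2))^-1.

Lemma measurable_comp_fst v :
  measurable_fun setT v -> measurable_fun setT (fun z : T * T => v z.1).
Proof. by move=> mv; apply: measurableT_comp. Qed.

Lemma measurable_comp_snd v :
  measurable_fun setT v -> measurable_fun setT (fun z : T * T => v z.2).
Proof. by move=> mv; apply: measurableT_comp. Qed.

Lemma measurable_comp_diff v :
  measurable_fun setT v -> measurable_fun setT (fun z : T * T => v (z.1 - z.2)).
Proof.
move=> mv; apply: (measurableT_comp mv).
by apply: measurable_rVB; [exact: measurable_fst|exact: measurable_snd].
Qed.

Lemma measurable_rdiff v :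
  measurable_fun setT v -> measurable_fun setT (rdiff v).
Proof.
move=> mv; apply: measurable_funB;
  [exact: measurable_comp_fst|exact: measurable_comp_snd].
Qed.

Lemma measurable_frac_weight s : measurable_fun setT (frac_weight s).
Proof.
exact: (measurable_comp_diff (measurable_frac_kernelV s)).
Qed.

Lemma frac_weight_ge0 s z : 0 <= frac_weight s z.
Proof. by rewrite invr_ge0 frac_kernel_ge0. Qed.

Lemma gagliardoE s v : measurable_fun setT v ->
  gagliardo s v = wnorm2 m (frac_weight s) (rdiff v).
Proof.
move=> mv; rewrite /wnorm2 fubini_tonelli1/=; last 2 first.
- apply: measurable_wnorm2; first exact: measurable_frac_weight.
  exact: measurable_rdiff.
- by move=> z; rewrite lee_fin mulr_ge0 ?frac_weight_ge0 ?sqr_ge0.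
apply: eq_integral => x _; apply: eq_integral => y _.
by rewrite real_normK ?num_real// mulrC.
Qed.

Lemma ae_eq_rdiff v v' : ae_eq mu setT v v' ->
  ae_eq m setT (rdiff v) (rdiff v').
Proof.
move=> vv'; have v1 := ae_fst mu vv'; have v2 := ae_snd mu vv'.
by apply: filterS2 v1 v2 => z v1 v2 _; rewrite /rdiff v1// v2.
Qed.

(** By Tonelli it is enough that, for every x, the set of y with x - y in a
    given null set is null: this is invariance under reflections. *)
Lemma ae_comp_diff (P : T -> Prop) :
  {ae mu, forall x, P x} -> {ae m, forall z : T * T, P (z.1 - z.2)}.
Proof.
move=> [A [mA A0 PA]]; exists [set z : T * T | A (z.1 - z.2)]; split.
- rewrite -[X in measurable X]setTI.
  exact: (measurable_rVB measurable_fst measurable_snd measurableT mA).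
- rewrite /product_measure1 integral0_eq// => x _ /=.
  rewrite (_ : xsection _ _ = (fun y => x - y) @^-1` A).
    by rewrite lebesgue_rV_reflect.
  by apply/seteqP; split => y; rewrite /xsection /= inE.
- by move=> z /= Pz; exact: PA.
Qed.

End pairs.

(** * The fractional Poincare inequality *)

Section poincare.
Local Open Scope ereal_scope.
Context (R : realType) (n : nat).
Local Notation T := 'rV[R]_n.
Local Notation mu := (lebesgue_rV R n).
Local Notation m := (mu \x mu).
Implicit Types (v : T -> R).

Definition l2norm2 v : \bar R := wnorm2 mu (cst 1%R) v.

(** The weight of the first two terms of the form: the Gagliardo kernel
    restricted to pairs of points that both lie outside of O. *)
Definition outer_weight (s : R) (O : set T) (z : T * T) : R :=
  (\1_(~` O) z.1 * \1_(~` O) z.2 * frac_weight s z)%R.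

Lemma l2norm2E v : l2norm2 v = \int[mu]_x (v x ^+ 2)%:E.
Proof. by apply: eq_integral => x _; rewrite mul1r. Qed.

Lemma outer_weight_ge0 s O z : (0 <= outer_weight s O z)%R.
Proof. by rewrite mulr_ge0 ?frac_weight_ge0// mulr_ge0. Qed.

Lemma measurable_outer_weight s O : measurable O ->
  measurable_fun setT (outer_weight s O).
Proof.
move=> mO; apply: measurable_funM; last exact: measurable_frac_weight.
have mI : measurable_fun setT (\1_(~` O) : T -> R).
  by apply: measurable_indic; exact: measurableC.
by apply: measurable_funM; [exact: measurable_comp_fst|exact: measurable_comp_snd].
Qed.

Lemma outer_weight_le s O z : (outer_weight s O z <= frac_weight s z)%R.
Proof.
rewrite /outer_weight !indicE.
by case: (_ \in _); case: (_ \in _); rewrite ?mul0r ?mulr0 ?mul1r ?mul0r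
  ?frac_weight_ge0.
Qed.

Lemma wnorm2_outer_le s O v : measurable O -> measurable_fun setT v ->
  wnorm2 m (outer_weight s O) (rdiff v) <=
  wnorm2 m (frac_weight s) (rdiff v).
Proof.
move=> mO mv; apply: ge0_le_integral => //.
- by move=> z _; rewrite lee_fin mulr_ge0 ?sqr_ge0 ?outer_weight_ge0.
- apply: measurable_wnorm2; first exact: measurable_outer_weight.
  exact: measurable_rdiff.
- apply: measurable_wnorm2; first exact: measurable_frac_weight.
  exact: measurable_rdiff.
- by move=> z _; rewrite lee_fin ler_wpM2r ?sqr_ge0// outer_weight_le.
Qed.

Variables (i0 : 'I_n) (s N delta : R) (O O' : set T).
Hypotheses (s0 : (0 < s)%R) (N0 : (0 <= N)%R) (delta0 : (0 < delta)%R)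
  (mO' : measurable O')
  (ON : forall x, O x -> (`|x| <= N)%R) (O'N : forall x, O' x -> (`|x| <= N)%R)
  (OO' : forall x y, O x -> O' y -> (delta <= `|x - y|)%R).

Let notO' x : O x -> ~ O' x.
Proof.
by move=> Ox O'x; have := OO' Ox O'x; rewrite subrr normr0 leNgt delta0.
Qed.

(** On O x B, where the cube B = [N+1, N+2]^n misses both domains, v(x) - v(y) is
    v(x) and the kernel is bounded below; integrating over y in B leaves a
    multiple of the squared L^2 norm of v. *)
Lemma poincare : exists2 c : R, (0 < c)%R & forall v, measurable_fun setT v ->
  (forall x, ~ O x -> v x = 0%R) ->
  c%:E * l2norm2 v <= wnorm2 m (outer_weight s O') (rdiff v).
Proof.
(* B is placed beyond the common bound N of O and O'. *)
pose B : set T := [set v | forall i, `[N + 1, N + 2]%classic (v 0%R i)]%R.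
have mB : measurable B by exact: measurable_rV_itv.
have Nge0 := N0.
have muB : mu B = 1.
  rewrite /B lebesgue_rV_itv; last by rewrite lerD2l ler1n.
  by rewrite (_ : N + 2 - (N + 1) = 1)%R ?expr1n//; ring.
have n0 : (0 < n%:R :> R)%R by rewrite ltr0n; case: (n) i0 => // -[].
have NB x : B x -> (N < `|x|)%R.
  move=> Bx; apply: lt_le_trans (coord_le_norm x i0).
  have := Bx i0; rewrite /= in_itv/= => /andP[N1 _].
  by apply: lt_le_trans (ler_norm _); lra.
have BN x : B x -> (`|x| <= N + 2)%R.
  move=> Bx; have N20 : (0 <= N + 2)%R by lra.
  apply/(rV_normP x N20) => i; have := Bx i; rewrite /= in_itv/= => /andP[N1 N2].
  by rewrite ger0_norm//; lra.
pose c : R := ((n%:R * (2 * N + 2)) `^ (n%:R + 2 * s))^-1%R.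
have c0 : (0 < c)%R by rewrite invr_gt0 powR_gt0// mulr_gt0//; lra.
exists c => // v mv v0; apply: (@le_trans _ _
    (\int[m]_z ((c * v z.1 ^+ 2) * \1_B z.2)%:E)).
  rewrite (@ge0_integral_prod _ _ _ _ _ mu mu (fun x => c * v x ^+ 2)%R)//.
  - rewrite integral_indic// setIT [X in _ <= _ * X](_ : _ = 1) ?mule1//.
    rewrite l2norm2E -ge0_integralZl//.
    + by apply/measurable_EFinP; exact: measurable_funX.
    + by move=> x _; rewrite lee_fin sqr_ge0.
    + by rewrite lee_fin ltW.
  - by apply: measurable_funM => //; exact: measurable_funX.
  - by move=> x; rewrite mulr_ge0 ?sqr_ge0 ?ltW.
apply: ge0_le_integral => //.
- by move=> z _; rewrite lee_fin mulr_ge0// mulr_ge0 ?sqr_ge0 ?ltW.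
- apply/measurable_EFinP; apply: measurable_funM.
    apply: (@measurable_comp_fst _ _ (fun x => c * v x ^+ 2)%R).
    by apply: measurable_funM => //; exact: measurable_funX.
  by apply: (@measurable_comp_snd _ _ (\1_B)); exact: measurable_indic.
- apply: measurable_wnorm2; first exact: measurable_outer_weight.
  exact: measurable_rdiff.
move=> [x y] _; rewrite lee_fin /=.
have [By|nBy] := pselect (B y); last first.
  rewrite indicE memNset// mulr0.
  by rewrite mulr_ge0 ?sqr_ge0 ?outer_weight_ge0.
have [Ox|nOx] := pselect (O x); last first.
  rewrite v0// expr0n/= mulr0 mul0r.
  by rewrite mulr_ge0 ?sqr_ge0 ?outer_weight_ge0.
have nO'y : ~ O' y by move=> /O'N; rewrite leNgt NB.
have nOy : ~ O y by move=> /ON; rewrite leNgt NB.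
rewrite /rdiff/= (v0 y)// subr0 /outer_weight !indicE/= !mem_set//; last exact: notO'.
rewrite mulr1 !mul1r ler_wpM2r ?sqr_ge0//; apply: frac_kernelV_ge.
- exact: ltW.
- by rewrite subr_eq0; apply/eqP => /= xy; apply: nOy; rewrite -xy.
- rewrite ler_wpM2l//; apply: (le_trans (ler_normB _ _)).
  by have := ON Ox; have := BN y By; rewrite /=; lra.
Qed.

(** If x or y lies in O', then v(x) - v(y) is nonzero only if the other point
    lies in O, at distance at least delta; this part of the Gagliardo integral
    is thus at most 2 delta^(-n-2s) |O'| times the squared L^2 norm of v. *)
Lemma gagliardo_le_outer : exists2 D : R, (0 <= D)%R &
  forall v, measurable_fun setT v -> (forall x, ~ O x -> v x = 0%R) ->
  wnorm2 m (frac_weight s) (rdiff v) <=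
  wnorm2 m (outer_weight s O') (rdiff v) + D%:E * l2norm2 v.
Proof.
pose k : R := (delta `^ (n%:R + 2 * s))^-1%R.
have k0 : (0 <= k)%R by rewrite invr_ge0 powR_ge0.
have muO' : mu O' <= ((2 * N) ^+ n)%:E.
  rewrite -(lebesgue_rV_cube _ N0); apply: le_measure; rewrite ?inE//.
    exact: measurable_cube.
have c0 : (0 <= (2 * N) ^+ n :> R)%R by rewrite exprn_ge0// mulr_ge0.
exists (2 * (k * (2 * N) ^+ n))%R; first by rewrite !mulr_ge0.
move=> v mv v0.
have mIO' : measurable_fun setT (fun x => k * \1_O' x : R)%R.
  by apply: measurable_funM => //; exact: measurable_indic.
have mv2 : measurable_fun setT (fun x => v x ^+ 2)%R by exact: measurable_funX.
have IO'0 x : (0 <= k * \1_O' x :> R)%R by rewrite mulr_ge0.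
have v20 x : (0 <= v x ^+ 2)%R by exact: sqr_ge0.
pose f1 (z : T * T) := ((k * \1_O' z.1) * v z.2 ^+ 2)%:E.
pose f2 (z : T * T) := (v z.1 ^+ 2 * (k * \1_O' z.2))%:E.
have mf1 : measurable_fun setT f1.
  apply/measurable_EFinP; apply: measurable_funM.
    exact: (measurable_comp_fst mIO').
  exact: (measurable_comp_snd mv2).
have mf2 : measurable_fun setT f2.
  apply/measurable_EFinP; apply: measurable_funM.
    exact: (measurable_comp_fst mv2).
  exact: (measurable_comp_snd mIO').
have kO' : \int[mu]_x (k * \1_O' x)%:E <= (k * (2 * N) ^+ n)%:E.
  under eq_integral do rewrite EFinM.
  rewrite ge0_integralZl//; last exact/measurable_EFinP/measurable_indic.
  by rewrite integral_indic// setIT EFinM lee_wpmul2l// lee_fin.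
have l20 : 0 <= l2norm2 v by rewrite l2norm2E; apply: integral_ge0 => x _; rewrite lee_fin.
have If1 : \int[m]_z f1 z <= (k * (2 * N) ^+ n)%:E * l2norm2 v.
  rewrite /f1 (@ge0_integral_prod _ _ _ _ _ mu mu (fun x => k * \1_O' x)%R
    (fun x => v x ^+ 2)%R)// -l2norm2E.
  by rewrite lee_wpmul2r.
have If2 : \int[m]_z f2 z <= (k * (2 * N) ^+ n)%:E * l2norm2 v.
  rewrite /f2 (@ge0_integral_prod _ _ _ _ _ mu mu (fun x => v x ^+ 2)%R
    (fun x => k * \1_O' x)%R)// -l2norm2E muleC.
  by rewrite lee_wpmul2r.
have f10 z : 0 <= f1 z by rewrite lee_fin mulr_ge0.
have f20 z : 0 <= f2 z by rewrite lee_fin mulr_ge0.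
have w0 z : 0 <= (outer_weight s O' z * rdiff v z ^+ 2)%:E.
  by rewrite lee_fin mulr_ge0 ?sqr_ge0 ?outer_weight_ge0.
have mw : measurable_fun setT (fun z => (outer_weight s O' z * rdiff v z ^+ 2)%:E).
  apply: measurable_wnorm2; first exact: measurable_outer_weight.
  exact: measurable_rdiff.
apply: (@le_trans _ _ (\int[m]_z ((outer_weight s O' z * rdiff v z ^+ 2)%:E +
    (f1 z + f2 z)))); last first.
  rewrite ge0_integralD//; last 2 first.
  - by move=> z _; rewrite adde_ge0.
  - exact: emeasurable_funD.
  rewrite leeD2l// ge0_integralD//.
  rewrite mulrDl mul1r EFinD ge0_muleDl ?lee_fin ?mulr_ge0//; exact: leeD.
apply: ge0_le_integral => //.
- by move=> z _; rewrite lee_fin mulr_ge0 ?sqr_ge0 ?frac_weight_ge0.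
- apply: measurable_wnorm2; first exact: measurable_frac_weight.
  exact: measurable_rdiff.
- by do 2 apply: emeasurable_funD => //.
move=> [x y] _; rewrite /f1 /f2 -!EFinD lee_fin /=.
have fwle a b : O a -> O' b -> (frac_weight s (a, b) <= k)%R.
  by move=> Oa O'b; apply: frac_kernelV_le; [exact: ltW| |exact: OO'].
have fwC a b : frac_weight s (a, b) = frac_weight s (b, a).
  by rewrite /frac_weight /= -frac_kernelN opprB.
rewrite /outer_weight !indicE !in_setC /= /rdiff/=.
have [hx|nhx] := pselect (O' x).
  have vx : v x = 0%R by apply: v0 => /notO'.
  rewrite (mem_set hx)/= !mul0r vx sub0r sqrrN expr0n/= mul0r add0r addr0 mulr1.
  have [Oy|nOy] := pselect (O y); last by rewrite v0// expr0n/= !mulr0.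
  by rewrite ler_wpM2r// fwC; exact: fwle.
have [hy|nhy] := pselect (O' y).
  have vy : v y = 0%R by apply: v0 => /notO'.
  rewrite (mem_set hy)/= mulr0 !mul0r vy subr0 expr0n/= mulr0 !add0r mulr1.
  have [Ox|nOx] := pselect (O x); last by rewrite v0// expr0n/= mulr0 mul0r.
  by rewrite mulrC ler_wpM2l//; exact: fwle.
rewrite !memNset//= mulr1 mul1r !mulr0 mul0r !addr0//.
Qed.

Lemma gagliardo_outer_equiv : exists2 K : R, (0 < K)%R &
  forall v, measurable_fun setT v -> (forall x, ~ O x -> v x = 0%R) ->
  wnorm2 m (frac_weight s) (rdiff v) <=
  K%:E * wnorm2 m (outer_weight s O') (rdiff v).
Proof.
have [c c0 cP] := poincare; have [D D0 DP] := gagliardo_le_outer.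
exists (1 + D / c)%R; first by rewrite ltr_wpDr// divr_ge0// ltW.
move=> v mv v0; apply: (le_trans (DP v mv v0)).
have W0 : 0 <= wnorm2 m (outer_weight s O') (rdiff v).
  by apply: wnorm2_ge0 => z; exact: outer_weight_ge0.
rewrite EFinD ge0_muleDl//; last by rewrite lee_fin divr_ge0// ltW.
rewrite mul1e leeD2l// EFinM -muleA lee_wpmul2l ?lee_fin//.
rewrite -[leLHS]mul1e -(mulVf (lt0r_neq0 c0)) EFinM -muleA.
by rewrite lee_wpmul2l ?lee_fin ?invr_ge0 ?(ltW c0)//; exact: cP.
Qed.

End poincare.

(** * The nonlocal coupling term *)

Section coupling.
Local Open Scope ereal_scope.
Context (R : realType) (n : nat).
Local Notation T := 'rV[R]_n.
Local Notation mu := (lebesgue_rV R n).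
Local Notation m := (mu \x mu).
Implicit Types (p : (T -> R) * (T -> R)).

(** The increment that takes the place of [rdiff] in the coupling term. *)
Definition cross p (z : T * T) : R := (p.1 z.1 - p.2 z.2)%R.

(** The absolute value makes the weight nonnegative everywhere; it does not change
    the integrals of the form when J is nonnegative almost everywhere. *)
Definition coupling_weight (J : T -> R) (O1 O2 : set T) (z : T * T) : R :=
  (\1_O1 z.1 * \1_O2 z.2 * `|J (z.1 - z.2)|)%R.

Lemma measurable_cross p : measurable_fun setT p.1 -> measurable_fun setT p.2 ->
  measurable_fun setT (cross p).
Proof.
by move=> m1 m2; apply: measurable_funB;
  [exact: measurable_comp_fst|exact: measurable_comp_snd].
Qed.

Lemma ae_eq_cross p q : ae_eq mu setT p.1 q.1 -> ae_eq mu setT p.2 q.2 ->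
  ae_eq m setT (cross p) (cross q).
Proof.
move=> pq1 pq2; have v1 := ae_fst mu pq1; have v2 := ae_snd mu pq2.
by apply: filterS2 v1 v2 => z v1 v2 _; rewrite /cross v1// v2.
Qed.

Lemma convolution_fst (g f : T -> R) :
  measurable_fun setT g -> measurable_fun setT f ->
  (forall x, (0 <= g x)%R) -> (forall x, (0 <= f x)%R) ->
  \int[m]_z (g (z.1 - z.2)%R * f z.1)%:E =
    (\int[mu]_x (g x)%:E) * (\int[mu]_x (f x)%:E).
Proof.
move=> mg mf g0 f0.
have I0 : 0 <= \int[mu]_x (g x)%:E by apply: integral_ge0 => x _; rewrite lee_fin.
rewrite fubini_tonelli1/=; last 2 first.
- apply/measurable_EFinP; apply: measurable_funM.
    exact: (measurable_comp_diff mg).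
  exact: (measurable_comp_fst mf).
- by move=> z; rewrite lee_fin mulr_ge0.
rewrite -ge0_integralZl//; last 2 first.
- exact/measurable_EFinP.
- by move=> x _; rewrite lee_fin.
apply: eq_integral => x _; rewrite /fubini_F /=.
rewrite -(@ge0_integral_rV_reflect R n x (EFin \o g)) /=; last 2 first.
- exact/measurable_EFinP.
- by move=> y; rewrite lee_fin.
rewrite -ge0_integralZr//.
- apply/measurable_EFinP; apply: (measurableT_comp mg).
  by apply: measurable_rVB => //; exact: measurable_cst.
- by move=> y _; rewrite lee_fin.
- by rewrite lee_fin.
Qed.

(** The roles of the two points are exchanged by reflecting the kernel. *)
Lemma convolution_snd (g f : T -> R) :
  measurable_fun setT g -> measurable_fun setT f ->
  (forall x, (0 <= g x)%R) -> (forall x, (0 <= f x)%R) ->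
  \int[m]_z (g (z.1 - z.2)%R * f z.2)%:E =
    (\int[mu]_x (g x)%:E) * (\int[mu]_x (f x)%:E).
Proof.
move=> mg mf g0 f0.
(* x |-> g (- x), in the form to which reflection invariance applies. *)
pose g' x := g (0 - x)%R.
have g'0 x : (0 <= g' x)%R by exact: g0.
have mg' : measurable_fun setT g'.
  apply: (measurableT_comp mg).
  by apply: measurable_rVB => //; exact: measurable_cst.
have -> : \int[mu]_x (g x)%:E = \int[mu]_x (g' x)%:E.
  apply/esym/(@ge0_integral_rV_reflect R n 0 (EFin \o g)).
    exact/measurable_EFinP.
  by move=> x; rewrite lee_fin.
rewrite -(convolution_fst mg' mf)//.
rewrite fubini_tonelli2/=; last 2 first.
- apply/measurable_EFinP; apply: measurable_funM.
    exact: (measurable_comp_diff mg).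
  exact: (measurable_comp_snd mf).
- by move=> z; rewrite lee_fin mulr_ge0.
rewrite fubini_tonelli1/=; last 2 first.
- apply/measurable_EFinP; apply: measurable_funM.
    exact: (measurable_comp_diff mg').
  exact: (measurable_comp_fst mf).
- by move=> z; rewrite lee_fin mulr_ge0.
apply: eq_integral => x _; apply: eq_integral => y _ /=.
by rewrite /g' sub0r opprB.
Qed.

Variables (J : T -> R) (O1 O2 : set T).
Hypotheses (mJ : measurable_fun setT J) (mO1 : measurable O1)
  (mO2 : measurable O2) (iJ : mu.-integrable setT (EFin \o J)).

Let Jp x := `|J x|%R.

Let mJp : measurable_fun setT Jp.
Proof. by apply: measurableT_comp. Qed.

Let Jp_ge0 x : (0 <= Jp x)%R. Proof. exact: normr_ge0. Qed.

Lemma coupling_weight_ge0 z : (0 <= coupling_weight J O1 O2 z)%R.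
Proof. by rewrite mulr_ge0 ?Jp_ge0// mulr_ge0. Qed.

Lemma measurable_coupling_weight : measurable_fun setT (coupling_weight J O1 O2).
Proof.
apply: measurable_funM; last exact: (measurable_comp_diff mJp).
apply: measurable_funM.
  by apply: (@measurable_comp_fst _ _ (\1_O1)); exact: measurable_indic.
by apply: (@measurable_comp_snd _ _ (\1_O2)); exact: measurable_indic.
Qed.

(** From (a - b)^2 <= 2 (a^2 + b^2) and Young's equality for the integral of
    |J(x - y)| u(x)^2, in both variables. *)
Lemma wnorm2_coupling_le : exists2 j : R, (0 <= j)%R & forall p,
  measurable_fun setT p.1 -> measurable_fun setT p.2 ->
  wnorm2 m (coupling_weight J O1 O2) (cross p) <=
  j%:E * (l2norm2 p.1 + l2norm2 p.2).
Proof.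
have Ioo : \int[mu]_x (Jp x)%:E < +oo.
  by have /integrableP[_] := iJ.
have I0 : 0 <= \int[mu]_x (Jp x)%:E by apply: integral_ge0 => x _; rewrite lee_fin.
pose j := fine (\int[mu]_x (Jp x)%:E).
have j0 : (0 <= j)%R by exact: fine_ge0.
have jE : \int[mu]_x (Jp x)%:E = j%:E by rewrite fineK// ge0_fin_numE.
exists (2 * j)%R; first by rewrite mulr_ge0.
move=> p m1 m2.
have m12 : measurable_fun setT (fun x => p.1 x ^+ 2)%R by exact: measurable_funX.
have m22 : measurable_fun setT (fun x => p.2 x ^+ 2)%R by exact: measurable_funX.
have l20 v : 0 <= l2norm2 v.
  by rewrite l2norm2E; apply: integral_ge0 => x _; rewrite lee_fin sqr_ge0.
pose f1 (z : T * T) := (Jp (z.1 - z.2) * p.1 z.1 ^+ 2)%:E.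
pose f2 (z : T * T) := (Jp (z.1 - z.2) * p.2 z.2 ^+ 2)%:E.
have mf1 : measurable_fun setT f1.
  apply/measurable_EFinP; apply: measurable_funM.
    exact: (measurable_comp_diff mJp).
  exact: (measurable_comp_fst m12).
have mf2 : measurable_fun setT f2.
  apply/measurable_EFinP; apply: measurable_funM.
    exact: (measurable_comp_diff mJp).
  exact: (measurable_comp_snd m22).
have f10 z : 0 <= f1 z by rewrite lee_fin mulr_ge0 ?sqr_ge0.
have f20 z : 0 <= f2 z by rewrite lee_fin mulr_ge0 ?sqr_ge0.
apply: (@le_trans _ _ (\int[m]_z (2%:E * (f1 z + f2 z)))); last first.
  rewrite ge0_integralZl//; last 2 first.
  - exact: emeasurable_funD.
  - by move=> z _; exact: adde_ge0.
  rewrite ge0_integralD// /f1 /f2 (convolution_fst mJp m12)//; last first.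
    by move=> x; exact: sqr_ge0.
  rewrite (convolution_snd mJp m22)//; last by move=> x; exact: sqr_ge0.
  by rewrite jE -!l2norm2E -ge0_muleDr ?l20// muleA -EFinM.
apply: ge0_le_integral => //.
- by move=> z _; rewrite lee_fin mulr_ge0 ?sqr_ge0 ?coupling_weight_ge0.
- apply: measurable_wnorm2; first exact: measurable_coupling_weight.
  exact: measurable_cross.
- by apply: measurable_funeM; exact: emeasurable_funD.
move=> z _; rewrite /f1 /f2 -EFinD -EFinM lee_fin -mulrDr [leRHS]mulrCA.
apply: ler_pM; rewrite ?sqr_ge0 ?coupling_weight_ge0//.
  rewrite /coupling_weight -/(Jp _) !indicE.
  by case: (_ \in _); case: (_ \in _); rewrite ?mul0r ?mulr0 ?mul1r ?mul0r ?Jp_ge0.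
rewrite /cross; have := sqr_ge0 (p.1 z.1 + p.2 z.2)%R; nra.
Qed.

End coupling.

(** * Closure of the test functions *)

Section test_function_lin.
Context (R : realType) (n : nat).
Local Notation T := 'rV[R]_n.
Implicit Types (f g : T -> R) (a : R).

Lemma iter_partial_lin a f g l : smooth f -> smooth g ->
  iter_partial l (fun x => a * f x + g x) =
  (fun x => a * iter_partial l f x + iter_partial l g x).
Proof.
move=> sf sg; elim: l => [//|i l IHl]; rewrite {1}/iter_partial /=.
rewrite -/(iter_partial l _) IHl; apply/funext => x.
have df := (sf l).2 i x; have dg := (sg l).2 i x.
rewrite (_ : (fun x => _) = a \*: iter_partial l f + iter_partial l g)//.
by rewrite (deriveD (derivableZ (k := a) df) dg) (deriveZ a df).
Qed.

Lemma smooth_lin a f g : smooth f -> smooth g ->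
  smooth (fun x => a * f x + g x).
Proof.
move=> sf sg l; rewrite iter_partial_lin//.
have [cf df] := sf l; have [cg dg] := sg l; split=> [x|i x].
  exact: (continuousD (continuousM (@cst_continuous _ _ a x) (cf x)) (cg x)).
by apply: derivableD => //; exact: derivableZ.
Qed.

Lemma test_function_lin (Om : set T) a f g :
  test_function Om f -> test_function Om g ->
  test_function Om (fun x => a * f x + g x).
Proof.
move=> [sf cf fO] [sg cg gO].
have sub : support_of (fun x => a * f x + g x) `<=` support_of f `|` support_of g.
  rewrite /support_of -closureU; apply: closure_subset => x /= fg.
  have [f0|f0] := eqVneq (f x) 0; last by left.
  by right; apply: contra_neq fg => ->; rewrite f0 mulr0 addr0.
split; first exact: smooth_lin.
- by apply: (subclosed_compact _ (compactU cf cg) sub); exact: closed_closure.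
- by apply: subset_trans sub _ => x [/fO|/gO].
Qed.

(** Open sets are measurable for the sigma-algebra of the coordinates. *)
Lemma continuous_measurable_rV f : continuous f -> measurable_fun setT f.
Proof.
move=> /continuousP cf; apply: (measurability _ (RGenOpens.measurableE R)).
move=> _ [_ [a [b ->] <-]]; rewrite setTI; apply: open_mrV.
exact/cf/interval_open.
Qed.

Lemma measurable_test_function (Om : set T) f :
  test_function Om f -> measurable_fun setT f.
Proof.
by move=> [sf _ _]; apply: continuous_measurable_rV; exact: (sf [::]).1.
Qed.

Lemma test_function_eq0 (Om : set T) f x : test_function Om f -> ~ Om x -> f x = 0.
Proof.
move=> [_ _ fO] Ox; apply/eqP; apply: contra_notT Ox => fx.
by apply: fO; exact: subset_closure.
Qed.

End test_function_lin.

Section frac_space.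
Local Open Scope ereal_scope.
Context (R : realType) (n : nat) (s : R) (Om : set 'rV[R]_n).
Local Notation T := 'rV[R]_n.
Local Notation mu := (lebesgue_rV R n).
Local Notation m := (mu \x mu).
Implicit Types (v : T -> R).

(** What the form uses of the closure of the test functions. A condition up to
    null sets is the right one, as membership in the closure is unaffected by
    measurable changes on null sets. *)
Definition frac_space v := [/\ measurable_fun setT v,
  wnorm2 m (frac_weight s) (rdiff v) < +oo &
  {ae mu, forall x, ~ Om x -> v x = 0%R}].

Lemma rdiff_lin (a : R) v v' :
  rdiff (fun x => a * v x + v' x)%R = (fun z => a * rdiff v z + rdiff v' z)%R.
Proof. by apply/funext => z; rewrite /rdiff; ring. Qed.

Lemma frac_space_wL2 v : frac_space v -> wL2 m (frac_weight s) (rdiff v).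
Proof. by case=> mv voo _; split => //; exact: measurable_rdiff. Qed.

Lemma Hs_norm2E v : measurable_fun setT v ->
  Hs_norm2 s v = l2norm2 v + wnorm2 m (frac_weight s) (rdiff v).
Proof.
move=> mv; rewrite /Hs_norm2 gagliardoE// l2norm2E; congr (_ + _).
by apply: eq_integral => x _; rewrite real_normK// num_real.
Qed.

Lemma l2norm2_ge0 v : 0 <= l2norm2 v.
Proof. by apply: wnorm2_ge0 => x; exact: ler01. Qed.

Lemma wnorm2_frac_ge0 v : 0 <= wnorm2 m (frac_weight s) (rdiff v).
Proof. by apply: wnorm2_ge0 => x; exact: frac_weight_ge0. Qed.

Lemma measurable_lin (a : R) v v' : measurable_fun setT v ->
  measurable_fun setT v' -> measurable_fun setT (fun x => a * v x + v' x)%R.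
Proof.
by move=> mv mv'; apply: measurable_funD => //; exact: measurable_funM.
Qed.

Lemma Hs_norm2_lin (a : R) v v' : measurable_fun setT v ->
  measurable_fun setT v' ->
  Hs_norm2 s (fun x => a * v x + v' x)%R <=
    (2 * a ^+ 2)%:E * Hs_norm2 s v + 2%:E * Hs_norm2 s v'.
Proof.
move=> mv mv'; rewrite !Hs_norm2E//; last exact: measurable_lin.
rewrite (ge0_muleDr _ (l2norm2_ge0 v) (wnorm2_frac_ge0 v)).
rewrite (ge0_muleDr _ (l2norm2_ge0 v') (wnorm2_frac_ge0 v')) [leRHS]addeACA.
rewrite rdiff_lin; apply: leeD.
  by rewrite /l2norm2; apply: wnorm2_lin => // x; exact: ler01.
apply: wnorm2_lin; first exact: measurable_frac_weight.
- by move=> z; exact: frac_weight_ge0.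
- exact: measurable_rdiff.
- exact: measurable_rdiff.
Qed.

Lemma Lfun_lin (a : R) v v' : v \in Lfun mu 2%:E -> v' \in Lfun mu 2%:E ->
  (fun x => a * v x + v' x)%R \in Lfun mu 2%:E.
Proof.
have p1 : 1 <= 2%:E :> \bar R by rewrite lee_fin ler1n.
by move=> vL v'L; exact: ((Lfun_submod_closed mu p1).2 a v v' vL v'L).
Qed.

Lemma measurable_Lfun v : v \in Lfun mu 2%:E -> measurable_fun setT v.
Proof. by move=> /sub_Lfun_mfun; rewrite inE. Qed.

Lemma tildeHs_lin (a : R) v v' : tildeHs s Om v -> tildeHs s Om v' ->
  tildeHs s Om (fun x => a * v x + v' x)%R.
Proof.
move=> [[vL voo] vA] [[v'L v'oo] v'A].
have mv := measurable_Lfun vL; have mv' := measurable_Lfun v'L.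
have a20 : (0 <= 2 * a ^+ 2)%R by rewrite mulr_ge0 ?sqr_ge0.
split; [split; first exact: Lfun_lin|].
  rewrite gagliardoE; last exact: measurable_lin.
  rewrite rdiff_lin; apply: (@wL2_lin _ _ _ m _ _ _ _ _ _ _ _).2.
  - exact: measurable_frac_weight.
  - by move=> z; exact: frac_weight_ge0.
  - by split; [exact: measurable_rdiff|rewrite -gagliardoE].
  - by split; [exact: measurable_rdiff|rewrite -gagliardoE].
move=> e e0; pose e' := (e / (2 * a ^+ 2 + 3))%R.
have d0 : (0 < 2 * a ^+ 2 + 3)%R by rewrite ltr_wpDl.
have e'0 : (0 < e')%R by rewrite divr_gt0.
have [phi tphi vphi] := vA e' e'0; have [psi tpsi v'psi] := v'A e' e'0.
have mphi := measurable_test_function tphi.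
have mpsi := measurable_test_function tpsi.
exists (fun x => a * phi x + psi x)%R; first exact: test_function_lin.
rewrite (_ : (_ \- _)%R = (fun x => a * (v \- phi) x + (v' \- psi) x)%R); last first.
  by apply/funext => x /=; ring.
apply: le_lt_trans (Hs_norm2_lin _ _ _) _; [exact: measurable_funB..|].
apply: (@le_lt_trans _ _ ((2 * a ^+ 2)%:E * e'%:E + 2%:E * e'%:E)).
  have two0 : 0 <= (2%R)%:E :> \bar R by rewrite lee_fin.
  have a2e : 0 <= (2 * a ^+ 2)%:E by rewrite lee_fin.
  exact: (leeD (lee_wpmul2l a2e (ltW vphi)) (lee_wpmul2l two0 (ltW v'psi))).
rewrite -!EFinM -EFinD lte_fin -mulrDl /e' mulrA ltr_pdivrMr// mulrC.
by rewrite ltr_pM2l// ltrD2l ltr_nat.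
Qed.

(** Test functions vanish outside of Om, so there the squared L^2 norm of v is
    that of v - phi, which is arbitrarily small. *)
Lemma tildeHs_frac_space v : measurable Om -> tildeHs s Om v -> frac_space v.
Proof.
move=> mOm [[vL voo] vA]; have mv := measurable_Lfun vL.
split => //; first by rewrite -gagliardoE.
have mOmC : measurable (~` Om) by exact: measurableC.
have mv2 (f : T -> R) : measurable_fun setT f ->
    measurable_fun setT (fun x => (f x ^+ 2)%:E).
  by move=> mf; apply/measurable_EFinP; exact: measurable_funX.
have le_e (e : R) : (0 < e)%R -> \int[mu]_(x in ~` Om) (v x ^+ 2)%:E <= e%:E.
  move=> e0; have [phi tphi vphi] := vA e e0.
  have mphi := measurable_test_function tphi.
  have mB : measurable_fun setT (v \- phi)%R by exact: measurable_funB.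
  apply: le_trans (ltW vphi); rewrite Hs_norm2E//.
  apply: (@le_trans _ _ (l2norm2 (v \- phi)%R)); last first.
    by rewrite leeDl// wnorm2_frac_ge0.
  rewrite l2norm2E.
  apply: (@le_trans _ _ (\int[mu]_(x in ~` Om) ((v \- phi)%R x ^+ 2)%:E)).
    rewrite le_eqVlt; apply/orP; left; apply/eqP; apply: eq_integral => x.
    by rewrite inE => Ox /=; rewrite (test_function_eq0 tphi Ox) subr0.
  apply: ge0_subset_integral => //; first exact: mv2.
  by move=> x _; rewrite lee_fin sqr_ge0.
have I0 : \int[mu]_(x in ~` Om) `|(v x ^+ 2)%:E| = 0.
  rewrite (eq_integral (fun x => (v x ^+ 2)%:E)); last first.
    by move=> x _ /=; rewrite ger0_norm// sqr_ge0.
  apply/eqP; rewrite eq_le; apply/andP; split; last first.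
    by apply: integral_ge0 => x _; rewrite lee_fin sqr_ge0.
  by apply/lee_addgt0Pr => e e0; rewrite add0e; exact: le_e.
have mvC : measurable_fun (~` Om) (fun x => (v x ^+ 2)%:E).
  by apply: measurable_funTS; exact: mv2.
have := (ae_eq_integral_abs mu mOmC mvC).1 I0.
apply: filterS => x vx0 Ox; have [] := vx0 Ox.
by move/eqP; rewrite expf_eq0/= => /eqP.
Qed.

End frac_space.

(** * Elementary inequalities and bounded sets *)

(** The discriminant argument; the case a = 0 forces b = 0, as an affine function
    bounded below is constant. *)
Lemma quadratic_form_CauchySchwarz (R : realFieldType) (a b c : R) :
  0 <= a -> (forall t, 0 <= a * t ^+ 2 + 2 * b * t + c) -> b ^+ 2 <= a * c.
Proof.
move=> a0 H; have [a00|an0] := eqVneq a 0.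
  have [->|b0] := eqVneq b 0; first by rewrite expr0n/= a00 mul0r.
  have := H (- (c + 1) / (2 * b)); rewrite a00 mul0r add0r.
  rewrite (_ : 2 * b * _ = - (c + 1)); last by field.
  by rewrite opprD addrAC addNr add0r oppr_ge0 ler10.
have agt0 : 0 < a by rewrite lt0r an0.
have := H (- b / a); rewrite (_ : _ + _ + c = (a * c - b ^+ 2) / a); last by field.
by rewrite pmulr_lge0 ?invr_gt0// subr_ge0.
Qed.

Lemma le_mul_of_sqr_le (R : realFieldType) (M x y a b c : R) :
  0 < M -> 0 <= x -> 0 <= y -> 0 <= a -> 0 <= c -> b ^+ 2 <= a * c ->
  a <= M * x ^+ 2 -> c <= M * y ^+ 2 -> b <= M * x * y.
Proof.
move=> M0 x0 y0 a0 c0 bac aM cM; apply: le_trans (ler_norm _) _.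
have Mxy0 : 0 <= M * x * y by rewrite mulr_ge0// mulr_ge0// ltW.
rewrite -ler_sqr ?nnegrE ?normr_ge0// real_normK ?num_real//.
apply: (le_trans bac); apply: (le_trans (ler_pM a0 c0 aM cM)).
by rewrite le_eqVlt; apply/orP; left; apply/eqP; ring.
Qed.

Lemma bounded_norm_le (R : realType) (n : nat) (A : set 'rV[R]_n) :
  bounded_set A -> exists2 N : R, 0 <= N & forall x, A x -> `|x| <= N.
Proof.
move=> [M [_ MA]]; exists (`|M| + 1); first by rewrite addr_ge0.
by apply: MA; rewrite (le_lt_trans (ler_norm _))// ltrDl.
Qed.

(** The closure of A is compact, so the local distances to B, positive because
    the closure of B is closed, have a common positive lower bound. *)
Lemma disjoint_closures_dist (R : realType) (n : nat) (A B : set 'rV[R]_n) :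
  bounded_set A -> closure A `&` closure B = set0 ->
  exists2 e : R, 0 < e & forall x y, A x -> B y -> e <= `|x - y|.
Proof.
move=> bA AB.
have cA : compact (closure A).
  apply: bounded_closed_compact; last exact: closed_closure.
  have [N N0 AN] := bounded_norm_le bA.
  exists N; split; first exact: num_real.
  move=> r Nr x; have clN : closed [set x : 'rV[R]_n | `|x| <= N].
    apply: (@closed_comp _ _ (fun x : 'rV[R]_n => `|x|) [set t : R | t <= N]).
      by move=> y _; exact: norm_continuous.
    exact: closed_le.
  move=> /(closure_subset (AN : A `<=` [set x | `|x| <= N])).
  rewrite -(closure_id _).1// => /= xN.
  exact: le_trans (ltW Nr).
have /(_ R (0^'+) (fun e x => forall y, B y -> e <= `|x - y|)) :=
  (compact_near_coveringP _).1 cA.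
case=> [x Ax|e /= e0 H].
- have nBx : (~` closure B) x by move=> Bx; have : set0 x by rewrite -AB.
  have oB : open (~` closure B) by rewrite openC; exact: closed_closure.
  have /nbhs_ballP[d /= d0 dB] : nbhs x (~` closure B) by exact: open_nbhs_nbhs.
  have d20 : 0 < d / 2 by rewrite divr_gt0.
  exists (ball x (d / 2), [set e : R | e < d / 2]); first split => /=.
  + exact: nbhsx_ballx.
  + exact: nbhs_right_lt.
  move=> [x' e] [/= x'x ed] y By.
  have : ~ ball x d y by move=> /dB; apply; exact: subset_closure.
  rewrite -!ball_normE /ball_ /= in x'x * => /negP; rewrite -leNgt => dxy.
  have := ler_distD x' x y; move: x'x ed dxy; lra.
exists (e / 2); first by rewrite divr_gt0.
have e2 : 0 < e / 2 by rewrite divr_gt0.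
move=> x y Ax By; apply: (H (e / 2)) => //; last exact: subset_closure.
rewrite /= sub0r normrN gtr0_norm//.
by rewrite ltr_pdivrMr// ltr_pMr// ltr1n.
Qed.

(** The arithmetic of the upper bound: in [pair_form_le], the a_i are the
    constants of the two fractional terms, y_1, y_2, y_3 the values of the three
    integrals, the g_i the squared Gagliardo seminorms and the l_i the squared
    L^2 norms. *)
Lemma weighted_sum_le (R : realFieldType) (a1 a2 j c1 c2 y1 y2 y3 g1 g2 l1 l2 : R) :
  0 <= a1 -> 0 <= a2 -> 0 <= j -> 0 < c1 -> 0 < c2 -> 0 <= g1 -> 0 <= g2 ->
  y1 <= g1 -> y2 <= g2 -> y3 <= j * (l1 + l2) ->
  c1 * l1 <= g1 -> c2 * l2 <= g2 ->
  a1 * y1 + a2 * y2 + y3 <= (a1 + a2 + j / c1 + j / c2) * (g1 + g2).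
Proof.
move=> a10 a20 j0 c10 c20 g10 g20 yg1 yg2 yl cg1 cg2.
have lg1 : l1 <= c1^-1 * g1 by rewrite ler_pdivlMl.
have lg2 : l2 <= c2^-1 * g2 by rewrite ler_pdivlMl.
have e1 : 0 <= j / c1 by rewrite divr_ge0// ltW.
have e2 : 0 <= j / c2 by rewrite divr_ge0// ltW.
have h1 := ler_wpM2l a10 yg1; have h2 := ler_wpM2l a20 yg2.
have h3 := le_trans yl (ler_wpM2l j0 (lerD lg1 lg2)).
have h4 : 0 <= a1 * g2 by rewrite mulr_ge0.
have h5 : 0 <= a2 * g1 by rewrite mulr_ge0.
have h6 : 0 <= j / c1 * g2 by rewrite mulr_ge0.
have h7 : 0 <= j / c2 * g1 by rewrite mulr_ge0.
move: h1 h2 h3 h4 h5 h6 h7; move: c1^-1 c2^-1 => d1 d2; nra.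
Qed.

Lemma weighted_sum_ge (R : realFieldType) (a1 a2 K1 K2 y1 y2 y3 g1 g2 : R) :
  0 < K1 -> 0 < K2 -> 0 <= a1 -> 0 <= a2 -> 0 <= g1 -> 0 <= g2 -> 0 <= y3 ->
  g1 <= K1 * y1 -> g2 <= K2 * y2 ->
  Num.min (a1 / K1) (a2 / K2) * (g1 + g2) <= a1 * y1 + a2 * y2 + y3.
Proof.
move=> K10 K20 a10 a20 g10 g20 y30 gy1 gy2.
have h1 : a1 / K1 * g1 <= a1 * y1 by rewrite -mulrA ler_wpM2l// ler_pdivrMl.
have h2 : a2 / K2 * g2 <= a2 * y2 by rewrite -mulrA ler_wpM2l// ler_pdivrMl.
rewrite mulrDr -[leLHS]addr0 lerD// lerD//.
  by apply: le_trans h1; rewrite ler_wpM2r// ge_min lexx.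
by apply: le_trans h2; rewrite ler_wpM2r// ge_min lexx orbT.
Qed.

(** * The form on pairs of functions *)

Section restriction.
Local Open Scope ereal_scope.
Context (R : realType) (n : nat).
Local Notation T := 'rV[R]_n.
Local Notation mu := (lebesgue_rV R n).
Local Notation m := (mu \x mu).
Implicit Types (v : T -> R).

Lemma ae_eq_indic_mul (O : set T) v :
  {ae mu, forall x, ~ O x -> v x = 0%R} ->
  ae_eq mu setT v (fun x => \1_O x * v x)%R.
Proof.
apply: filterS => x vx _; rewrite indicE.
have [Ox|nOx] := pselect (O x); first by rewrite mem_set// mul1r.
by rewrite memNset// mul0r vx.
Qed.

(** The two basic estimates ask for functions that vanish everywhere outside of O;
    multiplying v by the indicator of O changes it on a null set only. *)
Lemma frac_space_estimates (i0 : 'I_n) (s N delta : R) (O O' : set T) :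
  (0 < s)%R -> (0 <= N)%R -> (0 < delta)%R -> measurable O -> measurable O' ->
  (forall x, O x -> (`|x| <= N)%R) -> (forall x, O' x -> (`|x| <= N)%R) ->
  (forall x y, O x -> O' y -> (delta <= `|x - y|)%R) ->
  exists c K : R, [/\ (0 < c)%R, (0 < K)%R &
    forall v, frac_space s O v ->
      c%:E * l2norm2 v <= wnorm2 m (frac_weight s) (rdiff v) /\
      wnorm2 m (frac_weight s) (rdiff v) <=
        K%:E * wnorm2 m (outer_weight s O') (rdiff v)].
Proof.
move=> s0 N0 d0 mO mO' ON O'N OO'.
have [c c0 cP] := poincare i0 s0 N0 d0 mO' ON O'N OO'.
have [K K0 KP] := gagliardo_outer_equiv i0 s0 N0 d0 mO' ON O'N OO'.
exists c, K; split => // v [mv voo vO].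
pose v' x : R := (\1_O x * v x)%R.
have mv' : measurable_fun setT v' by apply: measurable_funM.
have vv' : ae_eq mu setT v v' by exact: ae_eq_indic_mul.
have v'0 x : ~ O x -> v' x = 0%R by move=> nOx; rewrite /v' indicE memNset// mul0r.
have dvv' := ae_eq_rdiff vv'.
have mdv := measurable_rdiff mv; have mdv' := measurable_rdiff mv'.
have mw := measurable_outer_weight s mO'.
rewrite /l2norm2 (ae_eq_wnorm2 _ mv mv' vv')//.
rewrite (ae_eq_wnorm2 (measurable_frac_weight s) mdv mdv' dvv').
rewrite (ae_eq_wnorm2 mw mdv mdv' dvv').
split; last exact: KP.
apply: le_trans (cP v' mv' v'0) _; exact: wnorm2_outer_le.
Qed.

Lemma EFin_wform_integral d (U : measurableType d) (nu : {measure set U -> \bar R})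
    (w f g : U -> R) :
  measurable_fun setT w -> (forall z, (0 <= w z)%R) ->
  wL2 nu w f -> wL2 nu w g ->
  (wform nu w f g)%:E = \int[nu]_z (w z * f z * g z)%:E.
Proof.
move=> mw w0 fL gL; rewrite /wform /Rintegral fineK//.
by apply: integrable_fin_num => //; exact: wL2_integrable.
Qed.

Lemma wL2_le d (U : measurableType d) (nu : {measure set U -> \bar R})
    (w w' f : U -> R) :
  measurable_fun setT w -> measurable_fun setT w' ->
  (forall z, (0 <= w z <= w' z)%R) -> wL2 nu w' f -> wL2 nu w f.
Proof.
move=> mw mw' ww' [mf foo]; split => //; apply: le_lt_trans foo.
apply: ge0_le_integral => //.
- by move=> z _; have /andP[w0 _] := ww' z; rewrite lee_fin mulr_ge0 ?sqr_ge0.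
- exact: measurable_wnorm2.
- exact: measurable_wnorm2.
- move=> z _; have /andP[_ h] := ww' z.
  by rewrite lee_fin ler_wpM2r ?sqr_ge0.
Qed.

End restriction.

Section iterated_integrals.
Local Open Scope ereal_scope.
Context (R : realType) (n : nat).
Local Notation T := 'rV[R]_n.
Local Notation mu := (lebesgue_rV R n).
Local Notation m := (mu \x mu).

Lemma iterated_outer_form (s : R) (O : set T) (v v' : T -> R) : measurable O ->
  wL2 m (outer_weight s O) (rdiff v) -> wL2 m (outer_weight s O) (rdiff v') ->
  \int[mu]_(x in ~` O) \int[mu]_(y in ~` O)
    ((v x - v y) * (v' x - v' y) / frac_kernel s (x - y))%:E =
  (wform m (outer_weight s O) (rdiff v) (rdiff v'))%:E.
Proof.
move=> mO vL v'L; have mw := measurable_outer_weight s mO.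
rewrite EFin_wform_integral//; last exact: outer_weight_ge0.
pose f z := (rdiff v z * rdiff v' z * frac_weight s z)%R.
have wE z : (outer_weight s O z * rdiff v z * rdiff v' z =
    \1_(~` O) z.1 * \1_(~` O) z.2 * f z)%R.
  by rewrite /f /outer_weight; ring.
under [RHS]eq_integral do rewrite wE.
rewrite -integral_rectangle//; [exact: measurableC|exact: measurableC|].
rewrite (_ : _ \o _ =
    EFin \o (fun z => outer_weight s O z * rdiff v z * rdiff v' z)%R).
  by apply: wL2_integrable => // z; exact: outer_weight_ge0.
by apply/funext => z /=; rewrite wE.
Qed.

(** This is where J >= 0 almost everywhere enters: it makes the weight with J and
    the weight with the absolute value of J agree almost everywhere. *)
Lemma iterated_coupling_form (J : T -> R) (O1 O2 : set T)
    (p q : (T -> R) * (T -> R)) :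
  measurable_fun setT J -> measurable O1 -> measurable O2 ->
  {ae mu, forall z, (0 <= J z)%R} ->
  wL2 m (coupling_weight J O1 O2) (cross p) ->
  wL2 m (coupling_weight J O1 O2) (cross q) ->
  \int[mu]_(x in O1) \int[mu]_(y in O2)
    (J (x - y) * (p.1 x - p.2 y) * (q.1 x - q.2 y))%:E =
  (wform m (coupling_weight J O1 O2) (cross p) (cross q))%:E.
Proof.
move=> mJ mO1 mO2 J0 pL qL; have mw := measurable_coupling_weight mJ mO1 mO2.
have [mp _] := pL; have [mq _] := qL.
rewrite EFin_wform_integral//; last exact: coupling_weight_ge0.
pose w z : R := (\1_O1 z.1 * \1_O2 z.2 * J (z.1 - z.2))%R.
pose f z := (J (z.1 - z.2)%R * cross p z * cross q z)%R.
have mw' : measurable_fun setT w.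
  apply: measurable_funM; last exact: (measurable_comp_diff mJ).
  by apply: measurable_funM; [apply: (@measurable_comp_fst _ _ (\1_O1))|
    apply: (@measurable_comp_snd _ _ (\1_O2))]; exact: measurable_indic.
have wE z : (w z * cross p z * cross q z = \1_O1 z.1 * \1_O2 z.2 * f z)%R.
  by rewrite /f /w; ring.
have ww' : ae_eq m setT (coupling_weight J O1 O2) w.
  have := ae_comp_diff J0; apply: filterS => z Jz _.
  by rewrite /coupling_weight /w ger0_norm.
rewrite (@ae_eq_wform _ _ _ m _ w _ (cross p) _ (cross q))//; try exact/aeW.
under [RHS]eq_integral do rewrite wE.
rewrite -integral_rectangle//.
rewrite (_ : _ \o _ = EFin \o (fun z => w z * cross p z * cross q z)%R); last first.
  by apply/funext => z /=; rewrite wE.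
apply: (le_integrable measurableT _ _ (wL2_integrable mw _ pL qL)).
- by apply/measurable_EFinP; exact: measurable_wform.
- move=> z _ /=; by rewrite lee_fin /w /coupling_weight !normrM !normr_id.
- exact: coupling_weight_ge0.
Qed.

End iterated_integrals.

Lemma frac_space_lin (R : realType) (n : nat) (s a : R) (O : set 'rV[R]_n) v v' :
  frac_space s O v -> frac_space s O v' ->
  frac_space s O (fun x => a * v x + v' x).
Proof.
move=> vV v'V; have [mv _ v0] := vV; have [mv' _ v'0] := v'V; split.
- exact: measurable_lin.
- rewrite rdiff_lin; apply: (wL2_lin (measurable_frac_weight s) _ a
    (frac_space_wL2 vV) (frac_space_wL2 v'V)).2.
  by move=> z; exact: frac_weight_ge0.
- by apply: filterS2 v0 v'0 => x v0 v'0 Ox; rewrite v0// v'0// mulr0 addr0.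
Qed.

Section pair_form.
Local Open Scope ereal_scope.
Context (R : realType) (n : nat) (i0 : 'I_n) (s1 s2 : R).
Local Notation T := 'rV[R]_n.
Local Notation mu := (lebesgue_rV R n).
Local Notation m := (mu \x mu).
Variables (O1 O2 : set T) (J : T -> R) (N delta : R).
Hypotheses (i00 : i0 = 0%N :> nat) (hs1 : (0 < s1 < 1)%R) (hs2 : (0 < s2 < 1)%R)
  (N0 : (0 <= N)%R) (delta0 : (0 < delta)%R)
  (mO1 : measurable O1) (mO2 : measurable O2)
  (O1N : forall x, O1 x -> (`|x| <= N)%R) (O2N : forall x, O2 x -> (`|x| <= N)%R)
  (O12 : forall x y, O1 x -> O2 y -> (delta <= `|x - y|)%R)
  (mJ : measurable_fun setT J) (J0 : {ae mu, forall z, (0 <= J z)%R})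
  (iJ : mu.-integrable setT (EFin \o J)).
Implicit Types (v : T -> R) (p q : (T -> R) * (T -> R)).

Let C1 : R := (frac_laplacian_const n s1 / 2)%R.
Let C2 : R := (frac_laplacian_const n s2 / 2)%R.
Let w1 := outer_weight s1 O2.
Let w2 := outer_weight s2 O1.
Let w3 := coupling_weight J O1 O2.

Let s10 : (0 < s1)%R. Proof. by case/andP: hs1. Qed.
Let s20 : (0 < s2)%R. Proof. by case/andP: hs2. Qed.
Let C10 : (0 < C1)%R.
Proof. by rewrite divr_gt0// (frac_laplacian_const_gt0 hs1 i00). Qed.
Let C20 : (0 < C2)%R.
Proof. by rewrite divr_gt0// (frac_laplacian_const_gt0 hs2 i00). Qed.
Let mw1 : measurable_fun setT w1. Proof. exact: measurable_outer_weight. Qed.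
Let mw2 : measurable_fun setT w2. Proof. exact: measurable_outer_weight. Qed.
Let mw3 : measurable_fun setT w3. Proof. exact: measurable_coupling_weight. Qed.
Let w1_ge0 z : (0 <= w1 z)%R. Proof. exact: outer_weight_ge0. Qed.
Let w2_ge0 z : (0 <= w2 z)%R. Proof. exact: outer_weight_ge0. Qed.
Let w3_ge0 z : (0 <= w3 z)%R. Proof. exact: coupling_weight_ge0. Qed.

Definition pair_space p := frac_space s1 O1 p.1 /\ frac_space s2 O2 p.2.

Definition pair_lin (a : R) p q : (T -> R) * (T -> R) :=
  ((fun x => a * p.1 x + q.1 x)%R, (fun x => a * p.2 x + q.2 x)%R).

(** Pairs are used instead of their sums, so that the form is defined without any
    choice of a decomposition. *)
Definition pair_form p q : R :=
  (C1 * wform m w1 (rdiff p.1) (rdiff q.1) +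
   C2 * wform m w2 (rdiff p.2) (rdiff q.2) +
   wform m w3 (cross p) (cross q))%R.

Definition pair_norm2 p : R :=
  (fine (wnorm2 m (frac_weight s1) (rdiff p.1)) +
   fine (wnorm2 m (frac_weight s2) (rdiff p.2)))%R.

Let est1 := frac_space_estimates i0 s10 N0 delta0 mO1 mO2 O1N O2N O12.
Let O21 x y : O2 x -> O1 y -> (delta <= `|x - y|)%R.
Proof. by move=> O2x O1y; rewrite distrC; exact: O12. Qed.
Let est2 := frac_space_estimates i0 s20 N0 delta0 mO2 mO1 O2N O1N O21.

Let wL2_w1 v : frac_space s1 O1 v -> wL2 m w1 (rdiff v).
Proof.
move=> vV; apply: (wL2_le mw1 (measurable_frac_weight s1)).
  by move=> z; rewrite w1_ge0 outer_weight_le.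
exact: frac_space_wL2 vV.
Qed.

Let wL2_w2 v : frac_space s2 O2 v -> wL2 m w2 (rdiff v).
Proof.
move=> vV; apply: (wL2_le mw2 (measurable_frac_weight s2)).
  by move=> z; rewrite w2_ge0 outer_weight_le.
exact: frac_space_wL2 vV.
Qed.

Let l2_lty s O v c : (0 < c)%R -> frac_space s O v ->
  c%:E * l2norm2 v <= wnorm2 m (frac_weight s) (rdiff v) -> l2norm2 v < +oo.
Proof.
move=> c0 [_ voo _] cv; rewrite ltey; apply/eqP => voo'.
by move: (le_lt_trans cv voo); rewrite voo' gt0_muley.
Qed.

Let fineK_l2 v : l2norm2 v < +oo -> (fine (l2norm2 v))%:E = l2norm2 v.
Proof. by move=> voo; rewrite fineK// ge0_fin_numE// l2norm2_ge0. Qed.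

Let fineK_frac s O v : frac_space s O v ->
  (fine (wnorm2 m (frac_weight s) (rdiff v)))%:E =
  wnorm2 m (frac_weight s) (rdiff v).
Proof. by move=> [_ voo _]; rewrite fineK// ge0_fin_numE// wnorm2_frac_ge0. Qed.

(** The first conclusion makes the coupling term finite; it follows from the same
    bounds, as the Poincare inequality places both components in L^2. *)
Lemma pair_form_le : exists2 M : R, (0 < M)%R &
  forall p, pair_space p ->
    wL2 m w3 (cross p) /\ (pair_form p p <= M * pair_norm2 p)%R.
Proof.
have [c1 [K1 [c10 K10 E1]]] := est1; have [c2 [K2 [c20 K20 E2]]] := est2.
have [j j0 Jle] := wnorm2_coupling_le mJ mO1 mO2 iJ.
exists (C1 + C2 + j / c1 + j / c2)%R.
  by rewrite ltr_wpDr ?divr_ge0 ?(ltW c20)// ltr_wpDr ?divr_ge0 ?(ltW c10)// addr_gt0.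
move=> p [p1 p2]; have [e1 f1] := E1 _ p1; have [e2 f2] := E2 _ p2.
have l1 := l2_lty c10 p1 e1; have l2 := l2_lty c20 p2 e2.
have [mp1 g1 _] := p1; have [mp2 g2 _] := p2.
have Jp := Jle p mp1 mp2.
have wL3 : wL2 m w3 (cross p).
  split; first exact: measurable_cross.
  by apply: le_lt_trans Jp _; rewrite lte_mul_pinfty ?lee_fin// lte_add_pinfty.
split=> //.
have Ew1 := EFin_wform mw1 w1_ge0 (wL2_w1 p1).
have Ew2 := EFin_wform mw2 w2_ge0 (wL2_w2 p2).
have Ew3 := EFin_wform mw3 w3_ge0 wL3.
have o1 := wnorm2_outer_le s1 mO2 mp1; have o2 := wnorm2_outer_le s2 mO1 mp2.
have fl1 := fineK_l2 l1; have fl2 := fineK_l2 l2.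
have fg1 := fineK_frac p1; have fg2 := fineK_frac p2.
rewrite -/w1 -Ew1 in o1; rewrite -/w2 -Ew2 in o2; rewrite -/w3 -Ew3 in Jp.
rewrite -fg1 in e1 o1; rewrite -fg2 in e2 o2; rewrite -fl1 in e1 Jp.
rewrite -fl2 in e2 Jp; rewrite -EFinD in Jp.
rewrite -EFinM !lee_fin in Jp e1 e2; rewrite !lee_fin in o1 o2.
by apply: (weighted_sum_le (ltW C10) (ltW C20) j0 c10 c20 _ _ o1 o2 Jp e1 e2);
  rewrite fine_ge0// wnorm2_frac_ge0.
Qed.

(** The coupling term is dropped, being nonnegative. *)
Lemma pair_form_ge : exists2 a : R, (0 < a)%R &
  forall p, pair_space p -> (a * pair_norm2 p <= pair_form p p)%R.
Proof.
have [c1 [K1 [c10 K10 E1]]] := est1; have [c2 [K2 [c20 K20 E2]]] := est2.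
exists (Num.min (C1 / K1) (C2 / K2))%R; first by rewrite lt_min (divr_gt0 C10 K10) (divr_gt0 C20 K20).
move=> p [p1 p2]; have [_ f1] := E1 _ p1; have [_ f2] := E2 _ p2.
have Ew1 := EFin_wform mw1 w1_ge0 (wL2_w1 p1).
have Ew2 := EFin_wform mw2 w2_ge0 (wL2_w2 p2).
have fg1 := fineK_frac p1; have fg2 := fineK_frac p2.
rewrite -/w1 -Ew1 in f1; rewrite -/w2 -Ew2 in f2.
rewrite -fg1 in f1; rewrite -fg2 in f2.
rewrite -EFinM lee_fin in f1 f2.
apply: (weighted_sum_ge K10 K20 (ltW C10) (ltW C20) _ _ _ f1 f2).
- by rewrite fine_ge0// wnorm2_frac_ge0.
- by rewrite fine_ge0// wnorm2_frac_ge0.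
- exact: wform_ge0.
Qed.

Lemma cross_lin (a : R) p q :
  cross (pair_lin a p q) = (fun z => a * cross p z + cross q z)%R.
Proof. by apply/funext => z; rewrite /cross /=; ring. Qed.

Let wL2_w3 p : pair_space p -> wL2 m w3 (cross p).
Proof. by have [M _ MP] := pair_form_le; move=> /MP[]. Qed.

Lemma pair_formC p q : pair_form p q = pair_form q p.
Proof.
rewrite /pair_form (wformC _ w1) (wformC _ w2) (wformC _ w3)//.
Qed.

Lemma pair_form_linl (a : R) p p' q :
  pair_space p -> pair_space p' -> pair_space q ->
  pair_form (pair_lin a p p') q = (a * pair_form p q + pair_form p' q)%R.
Proof.
move=> pV p'V qV; have [p1 p2] := pV; have [p'1 p'2] := p'V; have [q1 q2] := qV.
rewrite /pair_form cross_lin !rdiff_lin.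
rewrite (wform_linl mw1 w1_ge0 a (wL2_w1 p1) (wL2_w1 p'1) (wL2_w1 q1)).
rewrite (wform_linl mw2 w2_ge0 a (wL2_w2 p2) (wL2_w2 p'2) (wL2_w2 q2)).
rewrite (wform_linl mw3 w3_ge0 a (wL2_w3 pV) (wL2_w3 p'V) (wL2_w3 qV)).
by ring.
Qed.

Lemma pair_form_ge0 p : (0 <= pair_form p p)%R.
Proof.
by apply: addr_ge0; [apply: addr_ge0; apply: mulr_ge0; [exact: ltW|exact: wform_ge0|
  exact: ltW|exact: wform_ge0]|exact: wform_ge0].
Qed.

Lemma pair_space_lin (a : R) p q :
  pair_space p -> pair_space q -> pair_space (pair_lin a p q).
Proof.
by move=> [p1 p2] [q1 q2]; split; exact: frac_space_lin.
Qed.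

Lemma pair_form_CauchySchwarz p q : pair_space p -> pair_space q ->
  (pair_form p q ^+ 2 <= pair_form p p * pair_form q q)%R.
Proof.
move=> pV qV; apply: quadratic_form_CauchySchwarz; first exact: pair_form_ge0.
move=> t; have := pair_form_ge0 (pair_lin t p q).
have lV := pair_space_lin t pV qV.
rewrite pair_form_linl// (pair_formC p) (pair_formC q (pair_lin _ _ _)).
rewrite !pair_form_linl// (pair_formC q p).
by congr (0 <= _)%R; ring.
Qed.

Lemma ae_eq_pair_form p p' q : pair_space p -> pair_space p' -> pair_space q ->
  ae_eq mu setT p.1 p'.1 -> ae_eq mu setT p.2 p'.2 ->
  pair_form p q = pair_form p' q.
Proof.
move=> pV p'V qV e1 e2.
have [[mp1 _ _] [mp2 _ _]] := pV; have [[mp'1 _ _] [mp'2 _ _]] := p'V.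
have [[mq1 _ _] [mq2 _ _]] := qV.
rewrite /pair_form /wform /Rintegral.
rewrite (@ae_eq_wform _ _ _ m w1 w1 _ (rdiff p'.1) _ (rdiff q.1))//; first last.
- exact/aeW.
- exact: ae_eq_rdiff.
- exact/aeW.
- exact: measurable_rdiff.
- exact: measurable_rdiff.
- exact: measurable_rdiff.
- exact: measurable_rdiff.
rewrite (@ae_eq_wform _ _ _ m w2 w2 _ (rdiff p'.2) _ (rdiff q.2))//; first last.
- exact/aeW.
- exact: ae_eq_rdiff.
- exact/aeW.
- exact: measurable_rdiff.
- exact: measurable_rdiff.
- exact: measurable_rdiff.
- exact: measurable_rdiff.
rewrite (@ae_eq_wform _ _ _ m w3 w3 _ (cross p') _ (cross q))//; first last.
- exact/aeW.
- exact: ae_eq_cross.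
- exact/aeW.
- exact: measurable_cross.
- exact: measurable_cross.
- exact: measurable_cross.
- exact: measurable_cross.
Qed.

Lemma iterated_pair_form p q : pair_space p -> pair_space q ->
  C1%:E * (\int[mu]_(x in ~` O2) \int[mu]_(y in ~` O2)
     ((p.1 x - p.1 y) * (q.1 x - q.1 y) / frac_kernel s1 (x - y))%:E) +
  C2%:E * (\int[mu]_(x in ~` O1) \int[mu]_(y in ~` O1)
     ((p.2 x - p.2 y) * (q.2 x - q.2 y) / frac_kernel s2 (x - y))%:E) +
  \int[mu]_(x in O1) \int[mu]_(y in O2)
     (J (x - y) * (p.1 x - p.2 y) * (q.1 x - q.2 y))%:E = (pair_form p q)%:E.
Proof.
move=> pV qV; have [p1 p2] := pV; have [q1 q2] := qV.
rewrite (iterated_outer_form mO2 (wL2_w1 p1) (wL2_w1 q1)).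
rewrite (iterated_outer_form mO1 (wL2_w2 p2) (wL2_w2 q2)).
rewrite (iterated_coupling_form mJ mO1 mO2 J0 (wL2_w3 pV) (wL2_w3 qV)).
by rewrite -!EFinM -!EFinD.
Qed.

End pair_form.

(** * Components of the elements of H *)

Section components.
Context (R : realType) (n : nat) (s1 s2 : R) (Om1 Om2 : set 'rV[R]_n).
Local Notation mu := (lebesgue_rV R n).
Implicit Types (u v : 'rV[R]_n -> R) (p q : ('rV[R]_n -> R) * ('rV[R]_n -> R)).
Hypotheses (mO1 : measurable Om1) (mO2 : measurable Om2)
  (O12 : Om1 `&` Om2 = set0).

Lemma componentsP u : spaceH s1 s2 Om1 Om2 u ->
  decomposition s1 s2 Om1 Om2 u (components s1 s2 Om1 Om2 u).
Proof. by move=> [p up]; exact: (xgetPex (cst 0, cst 0) (ex_intro _ p up)). Qed.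

Lemma decomposition_pair_space u p : decomposition s1 s2 Om1 Om2 u p ->
  pair_space s1 s2 Om1 Om2 p.
Proof. by move=> [t1 t2 _]; split; exact: tildeHs_frac_space. Qed.

Lemma decomposition_lin (a : R) u v p q :
  decomposition s1 s2 Om1 Om2 u p -> decomposition s1 s2 Om1 Om2 v q ->
  decomposition s1 s2 Om1 Om2 (fun x => a * u x + v x) (pair_lin a p q).
Proof.
move=> [p1 p2 ->] [q1 q2 ->]; split; [exact: tildeHs_lin|exact: tildeHs_lin|].
by apply/funext => x /=; ring.
Qed.

(** Almost every point lies outside of one of the domains, where the corresponding
    components of both decompositions vanish; the other components then agree
    because the sums do. *)
Lemma decomposition_ae_uniq u p q :
  decomposition s1 s2 Om1 Om2 u p -> decomposition s1 s2 Om1 Om2 u q ->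
  ae_eq mu setT p.1 q.1 /\ ae_eq mu setT p.2 q.2.
Proof.
move=> up uq; have [[_ _ p1] [_ _ p2]] := decomposition_pair_space up.
have [[_ _ q1] [_ _ q2]] := decomposition_pair_space uq.
have pq x : p.1 x + p.2 x = q.1 x + q.2 x.
  have [_ _ up'] := up; have [_ _ uq'] := uq.
  by have := congr1 (fun f => f x) (etrans (esym up') uq').
(* Both components are compared on a single set of full measure. *)
suff H : {ae mu, forall x, p.1 x = q.1 x /\ p.2 x = q.2 x}.
  by split; apply: filterS H => x [].
apply: (filterS2 _ _ (filterI p1 q1) (filterI p2 q2)).
move=> x [p1x q1x] [p2x q2x].
have [xO1|nO1x] := pselect (Om1 x).
  have nO2x : ~ Om2 x by move=> O2x; have : set0 x by rewrite -O12.
  have := pq x; rewrite (p2x nO2x) (q2x nO2x) !addr0 => ->; split => //.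
have := pq x; rewrite (p1x nO1x) (q1x nO1x) !add0r => ->; split => //.
Qed.

Lemma spaceH_lin (a : R) u v : spaceH s1 s2 Om1 Om2 u ->
  spaceH s1 s2 Om1 Om2 v -> spaceH s1 s2 Om1 Om2 (fun x => a * u x + v x).
Proof. by move=> [p up] [q vq]; exists (pair_lin a p q); exact: decomposition_lin. Qed.

Lemma normH_pair_norm2 u : spaceH s1 s2 Om1 Om2 u ->
  normH s1 s2 Om1 Om2 u ^+ 2 = pair_norm2 s1 s2 (components s1 s2 Om1 Om2 u).
Proof.
move=> /componentsP/decomposition_pair_space[[m1 _ _] [m2 _ _]].
have sqr_norm s v : measurable_fun setT v -> tildeHs_norm s v ^+ 2 =
    fine (wnorm2 (mu \x mu)%E (frac_weight s) (rdiff v)).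
  move=> mv; rewrite /tildeHs_norm (gagliardoE s mv) sqr_sqrtr//.
  exact/fine_ge0/wnorm2_frac_ge0.
rewrite /normH sqr_sqrtr; last by apply: addr_ge0; exact: sqr_ge0.
rewrite /pair_norm2; congr (_ + _); exact: sqr_norm.
Qed.

End components.

(** * Bilinearity, continuity and coercivity *)

Unset Implicit Arguments.
Set Strict Implicit.
Set Printing Implicit Defensive.

Theorem lemma3p5 (R : realType) (n : nat) (s1 s2 : R)
    (Om1 Om2 : set 'rV[R]_n) (J : 'rV[R]_n -> R)
    (hn : (2 <= n)%N) (hs1 : 0 < s1 < 1) (hs2 : 0 < s2 < 1)
    (hOm1 : bounded_lipschitz_domain Om1)
    (hOm2 : bounded_lipschitz_domain Om2)
    (hdisj : closure Om1 `&` closure Om2 = set0)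
    (hJmeas : measurable_fun [set: 'rV[R]_n] J)
    (hJpos : {ae lebesgue_rV R n, forall z, 0 <= J z})
    (hJsym : {ae lebesgue_rV R n, forall z, J z = J (- z)})
    (hJint : (lebesgue_rV R n).-integrable setT (EFin \o J))
    (hJsupp : exists2 r : R, set_dist Om1 Om2 < r &
       [set z | enorm z < r] `<=` support_of J) :
  let H := spaceH s1 s2 Om1 Om2 in
  let A := formA s1 s2 Om1 Om2 J in
  [/\ forall u v, H u -> H v -> A u v \is a fin_num,
      bilinear_on H A &
      exists M alpha : R, [/\ 0 < M, 0 < alpha,
        forall u v, H u -> H v ->
          (A u v <= (M * normH s1 s2 Om1 Om2 u * normH s1 s2 Om1 Om2 v)%:E)%E &
        forall v, H v ->
          ((alpha * normH s1 s2 Om1 Om2 v ^+ 2)%:E <= A v v)%E]].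
Proof.
move=> H A.
have [_ oO1 _ bO1 _] := hOm1; have [_ oO2 _ bO2 _] := hOm2.
have mO1 := open_mrV oO1; have mO2 := open_mrV oO2.
have [N1 N10 O1N] := bounded_norm_le bO1.
have [N2 N20 O2N] := bounded_norm_le bO2.
have [delta delta0 O12] := disjoint_closures_dist bO1 hdisj.
(* A single bound for both domains, as the cube of the Poincare inequality has to
   avoid both. *)
pose N := N1 + N2.
have N0 : 0 <= N by rewrite addr_ge0.
have O1N' x : Om1 x -> `|x| <= N by move=> /O1N h; rewrite (le_trans h)// lerDl.
have O2N' x : Om2 x -> `|x| <= N by move=> /O2N h; rewrite (le_trans h)// lerDr.
have disj : Om1 `&` Om2 = set0.
  apply/seteqP; split => // x [xO1 xO2]; rewrite -hdisj.
  by split; exact: subset_closure.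
pose i0 : 'I_n := Ordinal (ltnW hn).
have i00 : i0 = 0%N :> nat by [].
have [M M0 MP] := pair_form_le i00 hs1 hs2 N0 delta0 mO1 mO2 O1N' O2N' O12 hJmeas hJint.
have [al al0 alP] := pair_form_ge J i00 hs1 hs2 N0 delta0 mO1 mO2 O1N' O2N' O12.
pose c := components s1 s2 Om1 Om2.
pose B := pair_form s1 s2 Om1 Om2 J.
have cP u : H u -> pair_space s1 s2 Om1 Om2 (c u).
  by move=> /componentsP/(decomposition_pair_space mO1 mO2).
(* The form as a real number; from here on only its values on pairs matter. *)
have AE u v : H u -> H v -> A u v = (B (c u) (c v))%:E.
  move=> Hu Hv; rewrite -(iterated_pair_form i00 hs1 hs2 N0 delta0 mO1 mO2
    O1N' O2N' O12 hJmeas hJpos hJint (cP _ Hu) (cP _ Hv)).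
  by rewrite /A /formA -/c; case: (c u) => u1 u2; case: (c v).
have BC p q : B p q = B q p by exact: pair_formC.
have Blin a p p' q := @pair_form_linl _ _ _ _ _ _ _ _ _ _ i00 hs1 hs2 N0 delta0
  mO1 mO2 O1N' O2N' O12 hJmeas hJint a p p' q.
have Alin a u u' v : H u -> H u' -> H v ->
    A (fun x => a * u x + u' x) v = (a%:E * A u v + A u' v)%E.
  move=> Hu Hu' Hv; have Hl := spaceH_lin a Hu Hu'.
  rewrite !AE// -EFinM -EFinD; congr EFin.
  (* The chosen components of a u + u' need not be the combination of the chosen
     components, but agree with it almost everywhere. *)
  have dl := decomposition_lin a (componentsP Hu) (componentsP Hu').
  have [e1 e2] := decomposition_ae_uniq mO1 mO2 disj (componentsP Hl) dl.
  rewrite -Blin; [|exact: cP|exact: cP|exact: cP].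
  apply: (ae_eq_pair_form mO1 mO2 hJmeas _ _ _ e1 e2).
  - exact: cP.
  - exact: decomposition_pair_space dl.
  - exact: cP.
have AC u v : H u -> H v -> A u v = A v u by move=> Hu Hv; rewrite !AE// BC.
split.
- by move=> u v Hu Hv; rewrite AE.
- split=> [a u u' v|a u v v'] Hu; first exact: Alin.
  move=> Hv Hv'; rewrite AC//; last exact: spaceH_lin.
  by rewrite Alin// !(AC u).
exists M, al; split => // [u v Hu Hv|v Hv]; last first.
  by rewrite AE// lee_fin normH_pair_norm2//; exact: alP (cP _ Hv).
rewrite AE// lee_fin.
have Bu : B (c u) (c u) <= M * normH s1 s2 Om1 Om2 u ^+ 2.
  by rewrite normH_pair_norm2//; exact: (MP _ (cP _ Hu)).2.
have Bv : B (c v) (c v) <= M * normH s1 s2 Om1 Om2 v ^+ 2.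
  by rewrite normH_pair_norm2//; exact: (MP _ (cP _ Hv)).2.
have CS := pair_form_CauchySchwarz i00 hs1 hs2 N0 delta0 mO1 mO2 O1N' O2N' O12
  hJmeas hJint (cP _ Hu) (cP _ Hv).
have nu0 : 0 <= normH s1 s2 Om1 Om2 u by exact: sqrtr_ge0.
have nv0 : 0 <= normH s1 s2 Om1 Om2 v by exact: sqrtr_ge0.
have B0 p : 0 <= B p p by exact: (pair_form_ge0 Om1 Om2 J i00 hs1 hs2 p).
exact: (le_mul_of_sqr_le M0 nu0 nv0 (B0 _) (B0 _) CS Bu Bv).
Qed.
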